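(* Let $p(\cdot),q(\cdot)\in\mathcal{P}(\mathbb{R}^n)$ be exponent functions such that $p(\cdot),q(\cdot)\in LH(\mathbb{R}^n)$, $1<p_-\le p_+<\infty$, $1<q_-\le q_+<\infty$, and $p(x)\le q(x)$ for all $x\in\mathbb{R}^n$. Let $a,b\in\mathbb{R}$ be constants such that $$-\frac{n}{q_+}<a\le b<\frac{n}{(p_-)'},$$ and suppose that for all $x\in\mathbb{R}^n$ $$\frac{1}{p(x)}-\frac{1}{q(x)}=\frac1n+\frac{a-b}{n}.$$ Then there exists a constant $C>0$, independent of $f$, such that for all $f\in C_0^\infty(\mathbb{R}^n)$, $$\left\||\cdot|^a f\right\|_{L^{q(\cdot)}(\mathbb{R}^n)}\le C\left\||\cdot|^b\nabla f\right\|_{L^{p(\cdot)}(\mathbb{R}^n)}.$$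
   Context: $\mathcal{P}(\mathbb{R}^n)$ is the set of Lebesgue measurable functions $p(\cdot):\mathbb{R}^n\to[1,\infty]$ (exponent functions); $p_-=\operatorname{ess\,inf}_{x\in\mathbb{R}^n}p(x)$ and $p_+=\operatorname{ess\,sup}_{x\in\mathbb{R}^n}p(x)$, and similarly for $q(\cdot)$. For a constant $t\in(1,\infty)$, $t'$ is the conjugate exponent, $\frac1t+\frac1{t'}=1$. $p(\cdot)\in LH(\mathbb{R}^n)$ (log-H\''older continuity) means: there is a constant $C_0$ with $|p(x)-p(y)|\le \frac{C_0}{-\log|x-y|}$ for all $x,y$ with $|x-y|<\frac12$, and there are constants $C_\infty$, $p_\infty$ with $|p(x)-p_\infty|\le\frac{C_\infty}{\log(e+|x|)}$ for all $x$. When $p_+<\infty$, $\|g\|_{L^{p(\cdot)}(\mathbb{R}^n)}=\inf\{\lambda>0:\int_{\mathbb{R}^n}(|g(x)|/\lambda)^{p(x)}\,dx\le1\}$ for measurable $g$, with value $\infty$ if the set is empty. For vector-valued $g$, $|g|$ is the Euclidean norm. $|\cdot|^a$ denotes the function $x\mapsto|x|^a$. $C_0^\infty(\mathbb{R}^n)$ is the set of compactly supported smooth functions. *)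

(* Defs.v *)
From HB Require Import structures.
From mathcomp Require Import all_boot all_order all_algebra.
From mathcomp Require Import all_classical all_reals all_analysis.
From mathcomp Require Import measurable_realfun ess_sup_inf.

Set Implicit Arguments.
Unset Strict Implicit.
Unset Printing Implicit Defensive.
Import Order.TTheory GRing.Theory Num.Theory.
Import numFieldNormedType.Exports.

Local Open Scope classical_set_scope.
Local Open Scope ring_scope.

Definition rV_display : measure_display -> measure_display.
Proof. exact. Qed.

(* R^n is 'rV[R]_n. Its base sigma-algebra is the product of the n Borel
   sigma-algebras, as for n.-tuple; the Lebesgue sigma-algebra is obtained
   below by completion. *)
Section borel_rV.
Context {R : realType} (n : nat).

Definition coord_rV (i : 'I_n) (x : 'rV[R]_n) : measurableTypeR R := x ord0 i.

Let rV_set0 : g_sigma_preimage coord_rV set0.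
Proof. exact: sigma_algebra0. Qed.

Let rV_setC A : g_sigma_preimage coord_rV A -> g_sigma_preimage coord_rV (~` A).
Proof. exact: sigma_algebraC. Qed.

Let rV_bigcup (F : (set 'rV[R]_n)^nat) :
  (forall i, g_sigma_preimage coord_rV (F i)) ->
  g_sigma_preimage coord_rV (\bigcup_i (F i)).
Proof. exact: sigma_algebra_bigcup. Qed.

HB.instance Definition _ := @isMeasurable.Build
  (rV_display default_measure_display)
  'rV[R]_n (g_sigma_preimage coord_rV) rV_set0 rV_setC rV_bigcup.

Lemma measurable_coord_rV (i : 'I_n) :
  measurable_fun [set: 'rV[R]_n] (coord_rV i).
Proof.
move=> _ Y mY; rewrite setTI; apply: sub_sigma_algebra => /=.
rewrite -bigcup_seq/=; exists i => /=; first by rewrite mem_index_enum.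
by exists Y => //; rewrite setTI.
Qed.

Lemma measurable_fun_rV d (T : measurableType d) (f : T -> 'rV[R]_n) :
  (forall i, measurable_fun [set: T] (coord_rV i \o f)) ->
  measurable_fun [set: T] f.
Proof.
move=> mf _ A mA; rewrite setTI.
have : g_sigma_preimage coord_rV `<=` [set A | measurable (f @^-1` A)].
  apply: smallest_sub.
  - split => /=.
    + by rewrite preimage_set0.
    + by move=> B mB; rewrite setTD preimage_setC; exact: measurableC.
    + by move=> F mF; rewrite preimage_bigcup; exact: bigcup_measurable.
  - rewrite -bigcup_seq => B [i _ [C mC <-]] /=; rewrite setTI -comp_preimage.
    by rewrite -[_ @^-1` _]setTI; exact: mf.
exact.
Qed.

End borel_rV.

Section lebesgue_step.
Context {R : realType} (n : nat).
Variable mu : {sigma_finite_measure set 'rV[R]_n -> \bar R}.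

Definition cons_rV (xv : measurableTypeR R * 'rV[R]_n) : 'rV[R]_n.+1 :=
  row_mx (xv.1)%:M xv.2.

Lemma cons_rV0 xv : cons_rV xv ord0 ord0 = xv.1.
Proof.
have e : ord0 = lshift n ord0 :> 'I_(1 + n) by exact: val_inj.
by have := row_mxEl (xv.1)%:M xv.2 ord0 ord0; rewrite -e => ->; rewrite mxE.
Qed.

Lemma cons_rVS xv (i : 'I_n) : cons_rV xv ord0 (lift ord0 i) = xv.2 ord0 i.
Proof.
have e : lift ord0 i = rshift 1 i :> 'I_(1 + n) by exact: val_inj.
by have := row_mxEr (xv.1)%:M xv.2 ord0 i; rewrite -e.
Qed.

Lemma measurable_cons_rV : measurable_fun [set: measurableTypeR R * 'rV[R]_n] cons_rV.
Proof.
apply: measurable_fun_rV => i; case: (unliftP ord0 i) => [j|] ->.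
- rewrite (_ : _ \o _ = coord_rV j \o snd); last first.
    by apply/funext => xv /=; rewrite /coord_rV cons_rVS.
  exact: measurableT_comp (measurable_coord_rV j) measurable_snd.
- rewrite (_ : _ \o _ = fst)//.
  by apply/funext => xv /=; rewrite /coord_rV cons_rV0.
Qed.

Definition cons_measure : set 'rV[R]_n.+1 -> \bar R :=
  pushforward (@lebesgue_measure R \x mu)%E cons_rV.

Let cons_measure0 : cons_measure set0 = 0%E.
Proof. by rewrite /cons_measure /pushforward preimage_set0 measure0. Qed.

Let cons_measure_ge0 A : (0 <= cons_measure A)%E.
Proof. by rewrite /cons_measure /pushforward measure_ge0. Qed.

Let cons_measure_sigma_additive : semi_sigma_additive cons_measure.
Proof.
move=> F mF tF mUF; rewrite /cons_measure /pushforward preimage_bigcup.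
apply: measure_semi_sigma_additive.
- by move=> k; rewrite -[X in measurable X]setTI; exact: measurable_cons_rV.
- apply/trivIsetP => /= i j _ _ ij; rewrite -preimage_setI.
  by move/trivIsetP : tF => ->//; rewrite preimage_set0.
- by rewrite -preimage_bigcup -[X in measurable X]setTI; exact: measurable_cons_rV.
Qed.

HB.instance Definition _ := isMeasure.Build _ _ _ cons_measure
  cons_measure0 cons_measure_ge0 cons_measure_sigma_additive.

Let behead_rV (v : 'rV[R]_n.+1) : 'rV[R]_n := \row_i v ord0 (lift ord0 i).

Let cons_measure_sigma_finite : sigma_finite setT cons_measure.
Proof.
have /sigma_finiteP[F [TF ndF Foo]] := sigma_finiteT (@lebesgue_measure R).
have /sigma_finiteP[G [TG ndG Goo]] := sigma_finiteT mu.
pose g (v : 'rV[R]_n.+1) : measurableTypeR R * 'rV[R]_n :=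
  (coord_rV ord0 v, behead_rV v).
have gK : cancel cons_rV g.
  move=> [x v]; rewrite /g /coord_rV cons_rV0/=; congr pair.
  by apply/rowP => i; rewrite mxE cons_rVS.
have mg : measurable_fun setT g.
  apply: measurable_fun_pair; first exact: measurable_coord_rV.
  apply: measurable_fun_rV => i.
  rewrite (_ : _ \o _ = coord_rV (lift ord0 i)); first exact: measurable_coord_rV.
  by apply/funext => v /=; rewrite /coord_rV mxE.
have mFG k : measurable (F k `*` G k).
  by apply: measurableX; [case: (Foo k)|case: (Goo k)].
exists (fun k => g @^-1` (F k `*` G k)).
  rewrite -preimage_bigcup; apply/esym; rewrite -subTset => v _ /=.
  have [/= i _ Fi] : (\bigcup_i F i) (g v).1 by rewrite -TF.
  have [/= j _ Gj] : (\bigcup_i G i) (g v).2 by rewrite -TG.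
  exists (maxn i j) => //; split.
  - by move: Fi; apply/subsetPset/ndF; rewrite leq_maxl.
  - by move: Gj; apply/subsetPset/ndG; rewrite leq_maxr.
move=> k; split; first by rewrite -[X in measurable X]setTI; exact: mg.
rewrite /cons_measure /pushforward -comp_preimage.
rewrite (_ : g \o cons_rV = id) ?preimage_id; last exact/funext.
have [mF Fk] := Foo k; have [mG Gk] := Goo k.
by rewrite product_measure1E// lte_mul_pinfty// ge0_fin_numE.
Qed.

HB.instance Definition _ := Measure_isSigmaFinite.Build _ _ _ cons_measure
  cons_measure_sigma_finite.

End lebesgue_step.

Fixpoint borel_lebesgue {R : realType} (n : nat) :
    {sigma_finite_measure set 'rV[R]_n -> \bar R} :=
  match n with
  | 0 => \d_(0 : 'rV[R]_0)
  | m.+1 => cons_measure (borel_lebesgue m)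
  end.

Definition box_rV {R : realType} {n : nat} (l r : 'rV[R]_n) : set 'rV[R]_n :=
  [set x | forall i, x ord0 i \in `[l ord0 i, r ord0 i]].

Lemma measurable_box_rV {R : realType} {n : nat} (l r : 'rV[R]_n) :
  measurable (box_rV l r).
Proof.
rewrite (_ : box_rV l r = \bigcap_(i in [set: 'I_n])
    (coord_rV i @^-1` `[l ord0 i, r ord0 i]%classic)); last first.
  by apply/seteqP; split=> x /= H i => [_|]; have := H i; [|apply].
apply: fin_bigcap_measurable => // i _.
by rewrite -[X in measurable X]setTI; exact: measurable_coord_rV.
Qed.

Lemma borel_lebesgue_box {R : realType} (n : nat) (l r : 'rV[R]_n) :
  (forall i, l ord0 i <= r ord0 i) ->
  borel_lebesgue n (box_rV l r) = (\prod_(i < n) (r ord0 i - l ord0 i))%:E.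
Proof.
elim: n l r => [|n IH] l r lr.
  by rewrite big_ord0 /= diracE mem_set//= => -[].
rewrite big_ord_recl /= /cons_measure /pushforward.
pose tl (v : 'rV[R]_n.+1) : 'rV[R]_n := \row_i v ord0 (lift ord0 i).
rewrite (_ : _ @^-1` _ =
    `[l ord0 ord0, r ord0 ord0]%classic `*` box_rV (tl l) (tl r)); last first.
  apply/seteqP; split=> [[x v] /= H|[x v] /= [H1 H2] i].
    split; first by have := H ord0; rewrite cons_rV0.
    by move=> i; have := H (lift ord0 i); rewrite cons_rVS !mxE.
  case: (unliftP ord0 i) => [j|] ->; last by rewrite cons_rV0.
  by rewrite cons_rVS; have := H2 j; rewrite !mxE.
rewrite product_measure1E//=; last exact: measurable_box_rV.
rewrite IH; last by move=> i; rewrite !mxE.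
rewrite lebesgue_measure_itv/= lte_fin EFinM; congr (_ * _)%E.
  by case: ltgtP (lr ord0) => // ->; rewrite subrr.
by congr EFin; apply: eq_bigr => i _; rewrite !mxE.
Qed.

(* Lebesgue measure on the sigma-algebra of Lebesgue (= Caratheodory)
   measurable subsets of R^n, which is the domain of this set function. *)
Definition lebesgue_rV {R : realType} (n : nat) :=
  @completed_measure_extension _ _ R (borel_lebesgue n).

Arguments lebesgue_rV R n : clear implicits.

HB.instance Definition _ (R : realType) (n : nat) :=
  Measure.on (lebesgue_rV R n).

HB.instance Definition _ (R : realType) (n : nat) :=
  @Measure_isSigmaFinite.Build _ _ _ (lebesgue_rV R n)
    (completed_measure_extension_sigma_finite (sigma_finiteT (borel_lebesgue n))).

Lemma lebesgue_rV_borel (R : realType) (n : nat) (A : set 'rV[R]_n) :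
  measurable A -> lebesgue_rV R n A = borel_lebesgue n A.
Proof. by move=> mA; rewrite /lebesgue_rV /completed_measure_extension/= measurable_mu_extE. Qed.

Lemma lebesgue_rV_box (R : realType) (n : nat) (l r : 'rV[R]_n) :
  (forall i, l ord0 i <= r ord0 i) ->
  lebesgue_rV R n (box_rV l r) = (\prod_(i < n) (r ord0 i - l ord0 i))%:E.
Proof.
move=> lr; rewrite lebesgue_rV_borel ?borel_lebesgue_box//.
exact: measurable_box_rV.
Qed.

Notation lebesgue_rVType R n :=
  (caratheodory_type (mu_ext (@borel_lebesgue R n))).

(* The library norm on 'rV[R]_n is the sup norm; |x| in R^n is this one. *)
Definition enorm {R : realType} {n : nat} (x : 'rV[R]_n) : R :=
  Num.sqrt (\sum_(i < n) x ord0 i ^+ 2).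

Section exponents.
Context {R : realType} {n : nat}.
Local Open Scope ereal_scope.

Definition exponent (p : 'rV[R]_n -> \bar R) : Prop :=
  measurable_fun [set: lebesgue_rVType R n] p /\ forall x, 1 <= p x.

Definition exponent_inf (p : 'rV[R]_n -> \bar R) : \bar R :=
  ess_inf (lebesgue_rV R n) p.

Definition exponent_sup (p : 'rV[R]_n -> \bar R) : \bar R :=
  ess_sup (lebesgue_rV R n) p.

(* At x = y the first bound reads |p x - p x| <= 0, since ln 0 = 0 and
   C0 / 0 = 0. Both conditions fail when p takes the value +oo. *)
Definition log_hoelder (p : 'rV[R]_n -> \bar R) : Prop :=
  (exists C0 : R, forall x y : 'rV[R]_n, (enorm (x - y) < 2^-1)%R ->
     `|p x - p y| <= (C0 / - ln (enorm (x - y)))%:E) /\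
  (exists Cinf pinf : R, forall x : 'rV[R]_n,
     `|p x - pinf%:E| <= (Cinf / ln (expR 1 + enorm x))%:E).

(* The norm of a vector-valued g is that of [enorm \o g].
   Only meant for exponents with finite essential supremum, so that [fine] is
   harmless: the exponent is infinite at most on a null set. *)
Definition luxemburg_norm (p : 'rV[R]_n -> \bar R) (g : 'rV[R]_n -> R) : \bar R :=
  ereal_inf [set lambda%:E | lambda in [set lambda : R | (0 < lambda)%R /\
    \int[lebesgue_rV R n]_x ((`|g x| / lambda) `^ fine (p x))%:E <= 1]].

End exponents.

Section smooth.
Context {R : realType} {n : nat}.

Definition partial (i : 'I_n) (f : 'rV[R]_n -> R) : 'rV[R]_n -> R :=
  'D_(delta_mx ord0 i) f.

Definition iter_partial (s : seq 'I_n) (f : 'rV[R]_n -> R) : 'rV[R]_n -> R :=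
  foldr partial f s.

Definition smooth (f : 'rV[R]_n -> R) : Prop :=
  forall s : seq 'I_n, continuous (iter_partial s f) /\
    forall (i : 'I_n) (x : 'rV[R]_n),
      derivable (iter_partial s f) x (delta_mx ord0 i).

Definition compactly_supported (f : 'rV[R]_n -> R) : Prop :=
  compact (closure [set x | f x != 0]).

Definition gradient (f : 'rV[R]_n -> R) (x : 'rV[R]_n) : 'rV[R]_n :=
  \row_i partial i f x.

End smooth.

(* Main.v *)
From HB Require Import structures.
Require Import Defs.
From mathcomp Require Import all_boot all_order all_algebra.
From mathcomp Require Import all_classical all_reals all_analysis.
From mathcomp Require Import measurable_realfun ess_sup_inf.
From mathcomp Require Import ring lra.
Import Order.TTheory GRing.Theory Num.Theory.
Import numFieldNormedType.Exports.
Local Open Scope classical_set_scope.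
Local Open Scope ring_scope.

(** Write al = 1 + a - b, so that 0 <= al <= 1 and n/p - al = n/q, and let |x|
    be the sup norm, which is comparable with the Euclidean one and whose balls
    are cubes of known measure.

    Integrating f along the rays t |-> x + t w, with w averaged over the cube of
    centre x and radius |x|/2, gives a representation in which only points
    farther from the origin than x occur ([outer_riesz_bound]):
      |f x| <= C int_(|z| >= |x|) |x-z|^(1-n) |grad f z| dz.
    With F = |x|^a |f| and G = |z|^b |grad f|, normalised so that the modular
    int G^p is at most 1, this says F x <= int K(x,z) G z dz, where the kernel K
    ([critical_kernel]) is |x|^(al-1) |x-z|^(1-n) for |x-z| <= |x|/2, a
    truncated fractional integral, and |x|^a |z|^(al-a-n) for the other z with
    |z| >= |x|, a dual Hardy operator.

    The bound for int F^q uses no maximal function. Compare everything with the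
    weights W(r,S) = r^-n min(r/S, S/r)^g ([shell_weight]), whose integral over
    r = |x-z| is bounded uniformly in z and S. Fix x with
    F x > |x|^(-n/q) min(|x|,1/|x|)^d; where this fails, F^q is below a fixed
    integrable function. Then for every z ([kernel_dichotomy])
      K(x,z) G z <= eta F x (W1 + W2 + G z ^ p z)
                    + C F x ^ (1 - q x) G z ^ p z (W3 + W4),
    where W1, ..., W4 are such weights, each evaluated at one of the radii |x-z|,
    |x|, |z|.
    After integration in z the first term is at most F x / 2, so that F x ^ q x
    is bounded by the integral in z of G z ^ p z (W3 + W4), and Tonelli's
    theorem concludes ([modular_bound]). The dichotomy is obtained by
    associating with x the radius s at which F x is a large multiple of
    s^(-n/q x): beyond radius s the kernel contributes little because the
    modular of G is at most 1; inside radius s the part of G that is small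
    compared with s^(-n/p) contributes little; what remains has s controlled by
    G z, so that F x ^ (q x - 1) can be bounded in terms of G z.

    The exponents are not constant, and p x, p z have to be exchanged in powers
    of |x|, |z|, |x-z| and s. For |x-z| <= |x|/2 these exchanges cost bounded
    factors, because log-Hoelder continuity bounds |p x - p z| |ln |x-z|| for close
    points and |p x - p z| ln |x| for points of comparable large size, and because
    the lower bound imposed on F bounds s by a power of |x|; in the Hardy part they
    also cost a small power of |z|/|x|, which a > -n/q_+ allows
    ([log_hoelder_admissible]).
    In logarithmic coordinates the dichotomy is a family of linear inequalities
    ([local_log_estimate], [hardy_log_estimate]). *)

Set Implicit Arguments.
Unset Strict Implicit.
Unset Printing Implicit Defensive.

(** * The kernel estimates in logarithmic coordinates *)

(** The part |x-z| <= |x|/2 of the kernel. Here X, Y, Z, phi, g stand for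
    ln |x|, ln |x-z|, ln |z|, ln F x, ln G z, and Ux = n/p x, Vx = n/q x. The
    radius e^s attached to x is defined by F x = e^(LA - Vx s), and the radius
    e^w attached to z by G z = e^(-Lc - Uz w). The three alternatives are: the
    contribution is negligible thanks to a shell weight, negligible thanks to
    G^p, or the main term. The assumed lower bound on phi only serves to bound
    s by a multiple of |X|, so that the oscillation bound also holds at the
    radius e^s. *)
Lemma local_log_estimate (R : realFieldType) (n al V0 U1 d L t : R) :
  0 < n -> 0 <= al <= 1 -> 0 < V0 -> U1 < n -> 0 < d -> 0 <= L -> 0 <= t ->
  exists g0 : R, 0 < g0 /\ forall E, 0 <= E -> exists LA Lc LC : R,
  forall (X Y Z Ux Uz P Q phi g : R),
    let Vx := Ux - al in
    0 <= P -> 0 <= Q -> P * Uz = n -> Q * Vx = n ->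
    V0 <= Vx -> V0 <= Uz - al -> Uz <= U1 -> Ux <= U1 ->
    `|Ux - Uz| * `|Y| <= L -> `|Ux - Uz| * `|X| <= L ->
    Y <= X -> `|X - Z| <= t ->
    - Vx * X - d * `|X| < phi ->
    let k := (al - 1) * X + (1 - n) * Y in
    let sx := Order.min ((LA - phi) / Vx) X in
    let sz := Order.min ((- Lc - g) / Uz) Z in
    [\/ k + g <= - E + phi - n * Y - g0 * `|Y - sx|,
        k + g <= - E + phi + g * P |
        k + g <= LC + (phi - phi * Q + g * P) - n * Y - g0 * `|Y - sz| ].
Proof.
move=> n0 /andP[al0 al1] V00 U1n d0 L0 t0.
pose g0 := Order.min 1 (Order.min V0 (n - U1)).
have g01 : g0 <= 1 by rewrite ge_min lexx.
have g0V : g0 <= V0 by rewrite !ge_min lexx orbT.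
have g0U : g0 <= n - U1 by rewrite !ge_min lexx !orbT.
have g00 : 0 < g0 by rewrite !lt_min ltr01 V00 subr_gt0.
exists g0; split => // E E0.
(* L1 bounds |Ux - Uz| |s|; LA and Lc absorb the factor e^-E and the
   oscillation of the exponents. *)
pose LA := E + L; pose L1 := L * (2 + d / V0) + n * (LA / V0).
pose Lc := E + L1; pose q := n / V0.
exists LA, Lc, (q * (LA + Lc) + L1 + 4 * t).
have LA0 : 0 <= LA by rewrite addr_ge0.
have dV : 0 <= d / V0 by rewrite divr_ge0// ltW.
have LAV : 0 <= LA / V0 by rewrite divr_ge0// ltW.
have L10 : 0 <= L1.
  by apply: addr_ge0; apply: mulr_ge0 => //; [exact: addr_ge0|exact: ltW].
have Lc0 : 0 <= Lc by rewrite addr_ge0.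
clearbody g0.
move=> X Y Z Ux Uz P Q phi g Vx P0 Q0 PU QV V0x V0z UzU UxU DY DX YX XZ Tphi k sx sz.
have Vx0 : 0 < Vx by exact: lt_le_trans V0x.
have Uz0 : 0 < Uz by lra.
rewrite {}/sx {}/sz.
set s := (LA - phi) / Vx.
set w := (- Lc - g) / Uz.
have phiE : phi = LA - Vx * s by rewrite /s mulrC divfK ?gt_eqF//; lra.
have gE : g = - Lc - Uz * w by rewrite /w mulrC divfK ?gt_eqF//; lra.
have phiQ : phi * Q = LA * Q - n * s by rewrite phiE -QV; ring.
have gP : g * P = - Lc * P - n * w by rewrite gE -PU; ring.
have Pq : P <= q by rewrite /q ler_pdivlMr// -PU ler_wpM2l//; lra.
have Qq : Q <= q by rewrite /q ler_pdivlMr// -QV ler_wpM2l.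
clearbody s w.
pose D := `|Ux - Uz|.
have D0 : 0 <= D by exact: normr_ge0.
have Dn : D <= n by rewrite /D ler_norml; move: V0x V0z UzU UxU U1n al0 V00; rewrite /Vx; clear; lra.
have DYX r : 0 <= Ux - Uz -> (Ux - Uz) * r <= D * `|r|.
  by move=> h; rewrite /D (ger0_norm h) ler_wpM2l// ler_norm.
have DE r : `|(Ux - Uz) * r| <= D * `|r| by rewrite normrM.
have {DE} DE r B : D * `|r| <= B -> - B <= (Ux - Uz) * r <= B.
  by move=> h; rewrite -ler_norml (le_trans (DE _)).
have /andP[DY1 DY2] := DE _ _ DY.
have alX : (al - 1) * X <= (al - 1) * Y by rewrite ler_wnM2l// subr_le0.
(* Beyond radius e^s: split at G z = |x-z|^(-Uz). *)
have [sY|Ys] := ltP s Y.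
  have -> : Order.min s X = s by rewrite min_l// (le_trans (ltW sY)).
  have Ys0 : 0 <= Y - s by rewrite subr_ge0 ltW.
  have VYs : V0 * (Y - s) <= Vx * (Y - s) by rewrite ler_wpM2r.
  have gYs : g0 * (Y - s) <= V0 * (Y - s) by rewrite ler_wpM2r.
  have [gle|ggt] := leP g (- Uz * Y).
    apply: Or31; rewrite ger0_norm//.
    rewrite /k phiE; move: alX DY1 DY2 gle VYs gYs L0; rewrite /Vx /LA; clear; lra.
  apply: Or32.
  have P1 : 0 <= P - 1.
    by rewrite subr_ge0 -(ler_pM2r Uz0) PU mul1r (le_trans UzU)// ltW.
  have := ler_wpM2r P1 (ltW ggt).
  rewrite (_ : - Uz * Y * (P - 1) = - n * Y + Uz * Y); last by rewrite -PU; ring.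
  have hV : 0 <= V0 * (Y - s) by rewrite mulr_ge0// ltW.
  rewrite /k phiE; move: hV alX DY1 DY2 VYs; rewrite /Vx /LA; clear; lra.
have Ds : D * `|s| <= L1.
  have dX : d * `|X| / V0 >= 0 by rewrite divr_ge0 ?mulr_ge0// ltW.
  have [s0|s0] := lerP s 0.
    apply: (@le_trans _ _ L).
      apply: le_trans DY; rewrite ler_wpM2l// (ler0_norm s0).
      by rewrite ler0_norm ?(le_trans Ys s0)// lerN2.
    rewrite /L1 mulrDr -addrA.
    have : 0 <= L * (d / V0) by rewrite mulr_ge0.
    have : 0 <= n * (LA / V0) by rewrite mulr_ge0// ltW.
    move: L0; clear; lra.
  have : V0 * (s - `|X|) <= LA + d * `|X|.
    have [h|h] := lerP s `|X|.
      have : V0 * (s - `|X|) <= 0 by rewrite pmulr_rle0// subr_le0.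
      have : 0 <= d * `|X| by rewrite mulr_ge0// ltW.
      move: LA0; clear; lra.
    have : V0 * (s - `|X|) <= Vx * (s - `|X|) by rewrite ler_wpM2r// subr_ge0 ltW.
    have : Vx * X <= Vx * `|X| by rewrite ler_wpM2l ?ler_norm// ltW.
    move: Tphi; rewrite phiE; clear; lra.
  rewrite mulrC -ler_pdivlMr// => h.
  have : s <= `|X| + LA / V0 + d * `|X| / V0.
    move: h; rewrite mulrDl; clear; lra.
  move=> sle; rewrite gtr0_norm//.
  apply: (le_trans (ler_wpM2l D0 sle)).
  rewrite /L1 2!mulrDr mulrDr -/D.
  have : D * (LA / V0) <= n * (LA / V0) by rewrite ler_wpM2r.
  have : D * (d * `|X| / V0) <= L * (d / V0).
    rewrite (_ : _ * _ = D * `|X| * (d / V0)); last by field; rewrite gt_eqF.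
    by rewrite ler_wpM2r.
  move: L0 (DX : D * `|X| <= L); clear; lra.
have /andP[Ds1 Ds2] := DE _ _ Ds.
(* Inside radius e^s: the small values of G. *)
have [gle|ggt] := leP g (- Lc - Uz * s).
  apply: Or31.
  rewrite ler0_norm; last by rewrite subr_le0 le_min Ys.
  rewrite /k phiE opprB.
  set tau := Order.min s X.
  have tX : tau <= X by rewrite ge_min lexx orbT.
  have ts : tau <= s by rewrite ge_min lexx.
  have Yt : Y <= tau by rewrite le_min Ys.
  have h1 : (al - 1) * X <= (al - 1) * tau by rewrite ler_wnM2l// subr_le0.
  have h2 : al * tau <= al * s by rewrite ler_wpM2l.
  have h3 : g0 * (tau - Y) <= tau - Y by rewrite ler_piMl// subr_ge0.
  move: h1 h2 h3 gle Ds1 Ds2 LA0; rewrite /Vx /Lc; clear; lra.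
(* The large values of G, for which w < s; since Y <= s as well, s can be
   replaced by its lower bound M = max(w, Y). *)
have ws : w < s.
  have : Uz * w < Uz * s by move: ggt; rewrite gE; clear; lra.
  by rewrite ltr_pM2l.
apply: Or33; rewrite phiQ gP phiE [in leLHS]gE.
have hQ : LA * Q <= q * LA by rewrite mulrC ler_wpM2r.
have hP : Lc * P <= q * Lc by rewrite mulrC ler_wpM2r.
set M := Order.max w Y.
have Ms : M <= s by rewrite ge_max (ltW ws) Ys.
have hM : (n - Uz + al) * M <= (n - Uz + al) * s.
  by rewrite ler_wpM2l// addr_ge0// subr_ge0 (le_trans UzU)// ltW.
suff : (al - 1) * X + Y + g0 * `|Y - Order.min w Z| <= 4 * t + (n - Uz) * (M - w) + al * M.
  move: hQ hP hM Ds1 Ds2 LA0 Lc0; rewrite /k /Vx; clear; lra.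
move: XZ; rewrite ler_norml => /andP[XZ1 XZ2].
rewrite {Ms hM hQ hP}/M; have [Yw|wY] := leP Y w.
  rewrite subrr mulr0 addr0.
  have [wZ|Zw] := leP w Z.
    rewrite ler0_norm ?subr_le0// opprB.
    have h3 : g0 * (w - Y) <= w - Y by rewrite ler_piMl// subr_ge0.
    have h4 : (1 - al) * w <= (1 - al) * (X + t).
      by rewrite ler_wpM2l ?subr_ge0//; move: wZ XZ1; clear; lra.
    have : al * t <= t by rewrite ler_piMl. have : 0 <= al * t by rewrite mulr_ge0.
    move: h3 h4 t0; clear; lra.
  have : `|Y - Z| <= Z - Y + 2 * t.
    by rewrite ler_norml; move: YX XZ1 XZ2 t0; clear; lra.
  move=> /(ler_wpM2l (ltW g00)) h.
  have h3 : g0 * (Z - Y + 2 * t) <= Z - Y + 2 * t by rewrite ler_piMl//; move: YX XZ1 XZ2 t0; clear; lra.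
  have h4 : (1 - al) * Z <= (1 - al) * (X + t).
    by rewrite ler_wpM2l ?subr_ge0//; move: XZ1; clear; lra.
  have h5 : al * Z <= al * w by rewrite ler_wpM2l// ltW.
  have : al * t <= t by rewrite ler_piMl. have : 0 <= al * t by rewrite mulr_ge0.
  move: h h3 h4 h5 t0; clear; lra.
have h : `|Y - Order.min w Z| <= Y - w + t.
  rewrite ler_norml; move: YX XZ1 XZ2 t0 wY; clear.
  by case: (leP w Z); lra.
have := ler_wpM2l (ltW g00) h.
have : g0 * (Y - w) <= (n - Uz) * (Y - w).
  by rewrite ler_wpM2r ?subr_ge0 ?(ltW wY)// (le_trans g0U)// lerD2l lerN2.
have : g0 * t <= t by rewrite ler_piMl.
have : (al - 1) * X <= (al - 1) * Y := alX.
move: t0; clear; lra.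
Qed.

(** The Hardy part |x| <= |z| of the kernel. With ph and gh the logarithms of
    F x |x|^(n/q x) and G z |z|^(n/p z), the kernel gains (|x|/|z|)^ep, half of
    which pays for the change of exponent. If ph > B the whole contribution is
    negligible because t <= 1 + t^p; if gh is small compared with ph it is
    negligible by the decay in |x|/|z|; otherwise ph is at most gh up to a
    constant and (q x - 1) ph has to be compared with (p z - 1) gh. This is
    immediate unless gh < 0 and p x < p z, and then the lower bound on ph
    limits gh from below. *)
Lemma hardy_log_estimate (R : realFieldType) (n al a ep d K q L E : R) :
  0 < ep -> 0 < d -> 0 <= K -> d * K <= ep / 2 -> 0 <= L -> 0 <= E ->
  exists LC : R,
  forall (X Z Ux Uz Px Pz Q phi g : R),
    let Vx := Ux - al in
    1 <= Px -> Px <= Q -> Q <= q -> 1 <= Pz -> Pz <= q ->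
    Pz * Uz = n -> Q * Vx = n -> X <= Z ->
    `|Px - Pz| * `|X| <= L + K * (Z - X) ->
    a * X + Vx * X - (a * Z + (Uz - al) * Z) <= L + ep * (X - Z) ->
    - Vx * X - d * `|X| < phi ->
    let k := a * X + (al - a - n) * Z in
    [\/ k + g <= - E + phi - n * Z - ep / 2 * `|Z - X|,
        k + g <= - E + phi + g * Pz |
        k + g <= LC + (phi - phi * Q + g * Pz) - n * X - ep / 2 * `|X - Z| ].
Proof.
move=> ep0 d0 K0 dK L0 E0; pose B := L + E.
exists (L + 5 * B * q + d * L) => X Z Ux Uz Px Pz Q phi g Vx Px1 PxQ Qq Pz1 Pzq PU QV XZ DP hQ Tphi k.
have B0 : 0 <= B by rewrite addr_ge0.
pose r := Z - X; have r0 : 0 <= r by rewrite subr_ge0.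
rewrite (distrC X) -/r (ger0_norm r0).
pose ph := phi + Vx * X; pose gh := g + Uz * Z.
have epr : 0 <= ep * r by rewrite mulr_ge0// ltW.
have key : k + g <= phi + L - ep * r - n * Z + gh - ph.
  by move: hQ; rewrite /k /gh /ph /r; clear; lra.
have gP : g * Pz = gh * Pz - n * Z by rewrite -PU /gh; ring.
have phQ : phi * Q = ph * Q - n * X by rewrite -QV /ph; ring.
have Tph : - (d * `|X|) < ph by move: Tphi; rewrite /ph; clear; lra.
rewrite gP phQ; clearbody k ph gh.
have BQ : B <= B * q by rewrite ler_peMr// (le_trans Px1)// (le_trans PxQ).
have [Bph|phB] := ltP B ph.
  have [gh0|gh0] := leP gh 0.
    by apply: Or31; move: key gh0 epr Bph; rewrite /B; clear; lra.
  apply: Or32; have : gh <= gh * Pz by rewrite ler_peMr// ltW.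
  by move: key epr Bph; rewrite /B; clear; lra.
have [gs|gl] := leP gh (ph - B + ep / 2 * r).
  by apply: Or31; move: key gs; rewrite /B; clear; lra.
apply: Or33.
suff : ph * (Q - 1) <= gh * (Pz - 1) + 5 * B * q + d * L + ep / 2 * r.
  by move: key; clear; lra.
have epr2 : 0 <= ep / 2 * r by move: epr; clear; lra.
have Q1 : 0 <= Q - 1 by rewrite subr_ge0 (le_trans Px1).
have dL : 0 <= d * L by rewrite mulr_ge0// ltW.
have Bq : B * (Q - 1) <= B * q by rewrite ler_wpM2l//; move: Qq; clear; lra.
have Bq0 : 0 <= B * q by exact: le_trans BQ.
have h1 : ph * (Q - 1) <= B * (Q - 1) by rewrite ler_wpM2r.
have [gh0|gh0] := leP 0 gh.
  have : 0 <= gh * (Pz - 1) by rewrite mulr_ge0// subr_ge0.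
  by move: h1 Bq Bq0 dL epr2; clear; lra.
pose p' := ph - 2 * B.
have p'0 : p' <= 0 by move: phB B0; rewrite /p'; clear; lra.
have p'g : p' <= gh by move: gl epr2 B0; rewrite /p'; clear; lra.
have h2 : ph * (Q - 1) <= p' * (Q - 1) + 2 * (B * q).
  by move: Bq; rewrite /p'; clear; lra.
have h3 : p' * (Q - 1) <= p' * (Px - 1) by rewrite ler_wnM2l// lerB.
have h4 : p' * (Px - 1) <= gh * (Px - 1) by rewrite ler_wpM2r// subr_ge0.
have [PP|PP] := leP Pz Px.
  have : gh * (Px - 1) <= gh * (Pz - 1) by rewrite ler_wnM2l ?lerB// ltW.
  by move: h2 h3 h4 Bq0 dL epr2; clear; lra.
have PP0 : 0 <= Pz - Px by rewrite subr_ge0 ltW.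
have h5 : - gh * (Pz - Px) <= (d * `|X| + 2 * B) * (Pz - Px).
  by rewrite ler_wpM2r//; move: p'g Tph; rewrite /p'; clear; lra.
have h6 : B * (Pz - Px) <= B * q.
  by rewrite ler_wpM2l//; move: Pzq Px1; clear; lra.
rewrite ler0_norm ?subr_le0 ?(ltW PP)// opprB in DP.
have h7 : d * ((Pz - Px) * `|X|) <= d * (L + K * (Z - X)) by rewrite ler_wpM2l// ltW.
have h8 : d * K * r <= ep / 2 * r by rewrite ler_wpM2r.
by move: h2 h3 h4 h5 h6 h7 h8 Bq0; rewrite -/r; clear; lra.
Qed.

(** * Cubes, Borel sets and Lebesgue measure *)

Section euclidean_borel.
Context {R : realType} {n : nat}.

Lemma le_coord_norm (x : 'rV[R]_n) (i : 'I_n) : `|x ord0 i| <= `|x|.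
Proof.
by rewrite [leRHS]/Num.norm /= mx_normrE; apply/bigmax_geP; right; exists (ord0, i).
Qed.

Lemma norm_rV_le (x : 'rV[R]_n) (r : R) : 0 <= r ->
  (`|x| <= r) = [forall i, `|x ord0 i| <= r].
Proof.
move=> r0; apply/idP/forallP => [h i|h]; first exact: le_trans (le_coord_norm _ _) h.
rewrite [leLHS]/Num.norm /= mx_normrE; apply/bigmax_leP; split => //= -[i j] _ /=.
by rewrite (ord1 i); exact: h.
Qed.

Definition cube (c : 'rV[R]_n) (r : R) : set 'rV[R]_n :=
  [set x | `|x - c| <= r].

Lemma cubeE c r : 0 <= r -> cube c r = box_rV (c - const_mx r) (c + const_mx r).
Proof.
move=> r0; apply/seteqP; split => x; rewrite /cube /box_rV /= norm_rV_le//.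
  by move=> /forallP h i; have := h i; rewrite !mxE in_itv/= ler_norml; lra.
move=> h; apply/forallP => i; have := h i; rewrite !mxE in_itv/= ler_norml; lra.
Qed.

Lemma measurable_cube c r : 0 <= r -> measurable (cube c r).
Proof. by move=> r0; rewrite cubeE//; exact: measurable_box_rV. Qed.

Lemma borel_lebesgue_cube c r : 0 <= r ->
  borel_lebesgue n (cube c r) = ((2 * r) ^+ n)%:E.
Proof.
move=> r0; rewrite cubeE// borel_lebesgue_box; last first.
  by move=> i; rewrite !mxE; lra.
congr EFin; rewrite (eq_bigr (fun=> 2 * r)); last by move=> i _; rewrite !mxE; ring.
by rewrite prodr_const card_ord.
Qed.

Lemma open_measurable_rV (U : set 'rV[R]_n) : open U -> measurable U.
Proof.
move=> oU.
(* U is the union of the cubes with rational centre and radius 1/(k+1) that it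
   contains. *)
pose c (q : 'rV[rat]_n) : 'rV[R]_n := map_mx (@ratr R) q.
pose D := [set u : 'rV[rat]_n * nat | cube (c u.1) u.2.+1%:R^-1 `<=` U].
have -> : U = \bigcup_(u in D) cube (c u.1) u.2.+1%:R^-1.
  apply/seteqP; split => [x Ux|x [u Du]]; last exact: Du.
  have /nbhs_ballP[e /= e0 xeU] : nbhs x U by exact: open_nbhs_nbhs.
  have [k ke] : exists k : nat, k.+1%:R^-1 < e / 2.
    by have [k _ /(_ k (leqnn k))] := near_infty_natSinv_lt (PosNum (divr_gt0 e0 (@ltr0n R 2))); exists k.
  have [d dE] : exists d : R, d = k.+1%:R^-1 by exists k.+1%:R^-1.
  have d0 : 0 < d by rewrite dE invr_gt0.
  rewrite -dE in ke.
  have /choice[q qx] : forall i, exists q : rat, `|x ord0 i - ratr q| <= d :> R.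
    move=> i; have : x ord0 i - d < x ord0 i + d by lra.
    move=> /rat_in_itvoo[q]; rewrite in_itv/= => /andP[q1 q2].
    by exists q; rewrite ler_norml; lra.
  pose qq : 'rV[rat]_n := \row_i q i.
  have xq : `|x - c qq| <= d.
    rewrite norm_rV_le ?ltW//; apply/forallP => i; rewrite !mxE; exact: qx.
  exists (qq, k); rewrite /D /cube /= -dE// => y /= yq.
  apply: xeU; rewrite -ball_normE /ball_ /=.
  rewrite (_ : x - y = (x - c qq) - (y - c qq)); last by rewrite opprB addrA subrK.
  apply: le_lt_trans (ler_normB _ _) _; lra.
rewrite bigcup_mkcond; apply: countable_bigcupT_measurable => // u.
by case: ifPn => // _; apply: measurable_cube.
Qed.

Lemma continuous_measurable_rV (f : 'rV[R]_n -> R) :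
  continuous f -> measurable_fun [set: 'rV[R]_n] f.
Proof.
move=> /continuousP cf; apply: (measurability _ (RGenOpens.measurableE R)).
move=> _ [_ [a [b ->] <-]]; rewrite setTI.
by apply: open_measurable_rV; exact/cf/interval_open.
Qed.

Lemma measurable_norm_rV : measurable_fun [set: 'rV[R]_n] (fun x => `|x|).
Proof. by apply: continuous_measurable_rV; exact: norm_continuous. Qed.

(** The identity from the completed to the Borel sigma-algebra is measurable and
    pushes the completed measure to the Borel one, so completion does not change
    the integral of a Borel function. *)
Lemma ge0_integral_lebesgue_rV (f : 'rV[R]_n -> \bar R) :
  measurable_fun [set: 'rV[R]_n] f -> (forall x, (0 <= f x)%E) ->
  (\int[lebesgue_rV R n]_x f x = \int[borel_lebesgue n]_x f x)%E.
Proof.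
move=> mf f0.
pose phi : lebesgue_rVType R n -> 'rV[R]_n := id.
have mphi : measurable_fun setT phi.
  move=> _ A mA; rewrite setTI.
  by apply: (@sub_caratheodory _ _ _ (borel_lebesgue n)); exact: sub_sigma_algebra.
rewrite [LHS](_ : _ = \int[pushforward (lebesgue_rV R n) phi]_x f x)%E; last first.
  by rewrite (@ge0_integral_pushforward _ _ _ _ _ _ mphi (lebesgue_rV R n) setT).
apply: eq_measure_integral => A mA _; rewrite /pushforward.
exact: lebesgue_rV_borel.
Qed.

End euclidean_borel.

Section cons_integral.
Context {R : realType}.
Local Open Scope ereal_scope.

Lemma ge0_integral_borel_lebesgueS (n : nat) (h : 'rV[R]_n.+1 -> \bar R) :
  measurable_fun [set: 'rV[R]_n.+1] h -> (forall x, 0 <= h x) ->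
  \int[borel_lebesgue n.+1]_x h x =
  \int[@lebesgue_measure R]_s \int[borel_lebesgue n]_v h (cons_rV (s, v)).
Proof.
move=> mh h0.
rewrite [LHS](_ : _ = \int[pushforward (@lebesgue_measure R \x borel_lebesgue n) (@cons_rV R n)]_x h x)//.
rewrite (@ge0_integral_pushforward _ _ _ _ _ _ (@measurable_cons_rV R n) _ setT)//= preimage_setT.
rewrite (fubini_tonelli1 (h \o @cons_rV R n))//.
  exact: measurableT_comp mh (@measurable_cons_rV R n).
by move=> z; exact: h0.
Qed.

Lemma ge0_integral_affine1 (h : R -> \bar R) (c t : R) : (0 < t)%R ->
  measurable_fun [set: measurableTypeR R] h -> (forall x, 0 <= h x) ->
  \int[@lebesgue_measure R]_s h (c + t * s)%R =
  (t^-1)%:E * \int[@lebesgue_measure R]_s h s.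
Proof.
move=> t0 mh h0.
pose phi (s : measurableTypeR R) : measurableTypeR R := (c + t * s)%R.
have mphi : measurable_fun setT phi.
  by apply: measurable_funD => //; exact: measurable_funM.
have tn0 : (0 <= t)%R by exact: ltW.
have [pm pmE] : exists pm : {measure set (measurableTypeR R) -> \bar R},
    pm = pushforward (@lebesgue_measure R) phi :> (set _ -> _).
  unshelve eexists (pushforward (@lebesgue_measure R) phi : {measure set (measurableTypeR R) -> \bar R}) => //; exact: mphi.
pose m := mscale (NngNum tn0) pm.
have mA A : m A = t%:E * @lebesgue_measure R (phi @^-1` A).
  by move: (congr1 (fun f => f A) pmE); rewrite /m /mscale /= => ->.
have mE A : measurable A -> @lebesgue_measure R A = m A.
  apply: lebesgue_measure_unique => _ [[a b] _ <-].
  rewrite -[RHS]/(m _) mA /=.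
  rewrite (_ : phi @^-1` _ = `](t^-1 * (a - c))%R, (t^-1 * (b - c))%R]%classic); last first.
    apply/seteqP; split => s /=; rewrite !in_itv/= /phi => /andP[h1 h2]; apply/andP.
      by rewrite ltr_pdivrMl// ler_pdivlMl//; split; lra.
    move: h1 h2; rewrite ltr_pdivrMl// ler_pdivlMl//; split; lra.
  rewrite !lebesgue_measure_itv/= !lte_fin.
  rewrite ltr_pM2l ?invr_gt0// ltrD2r; case: ifPn => _; last by rewrite mule0.
  by rewrite -!EFinD -EFinM; congr EFin; field; rewrite gt_eqF.
rewrite [in RHS](@eq_measure_integral _ _ _ setT m); last by move=> A ? _; exact: mE.
rewrite ge0_integral_mscale//= muleA -EFinM mulVf ?gt_eqF// mul1e.
rewrite pmE (@ge0_integral_pushforward _ _ _ _ _ _ mphi _ setT)//.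
Qed.

Lemma measurable_affine_rV (n : nat) (c : 'rV[R]_n) (t : R) :
  measurable_fun [set: 'rV[R]_n] (fun v : 'rV[R]_n => (c + t *: v)%R).
Proof.
apply: measurable_fun_rV => i.
rewrite (_ : _ \o _ = (fun v => c ord0 i + t * coord_rV i v)%R); last first.
  by apply/funext => v; rewrite /coord_rV /= !mxE.
apply: measurable_funD => //; apply: measurable_funM => //.
exact: measurable_coord_rV.
Qed.

(** The dimension is increased one coordinate at a time; the one-dimensional case
    is the uniqueness of Lebesgue measure. *)
Lemma ge0_integral_affine (n : nat) (h : 'rV[R]_n -> \bar R) (c : 'rV[R]_n) (t : R) :
  (0 < t)%R -> measurable_fun [set: 'rV[R]_n] h -> (forall x, 0 <= h x) ->
  \int[borel_lebesgue n]_v h (c + t *: v)%R =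
  (t ^- n)%:E * \int[borel_lebesgue n]_v h v.
Proof.
move=> t0; elim: n h c => [|n IH] h c mh h0.
  rewrite expr0 invr1 mul1e; apply: eq_integral => v _; congr h.
  by apply/rowP => -[].
have mc : measurable_fun setT (fun v : 'rV[R]_n.+1 => h (c + t *: v)%R).
  exact: measurableT_comp mh (measurable_affine_rV _ _).
rewrite !ge0_integral_borel_lebesgueS//.
pose c' : 'rV[R]_n := \row_i c ord0 (lift ord0 i).
have E s v : (c + t *: cons_rV (s, v) = cons_rV (c ord0 ord0 + t * s, c' + t *: v))%R.
  apply/rowP => i; rewrite mxE [X in (_ + X)%R]mxE; case: (unliftP ord0 i) => [j|] ->.
    by rewrite !cons_rVS/= !mxE.
  by rewrite !cons_rV0.
have mcons : measurable_fun [set: measurableTypeR R * 'rV[R]_n] (h \o @cons_rV R n).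
  exact: measurableT_comp mh (@measurable_cons_rV R n).
have mh1 s : measurable_fun [set: 'rV[R]_n] (fun v => h (cons_rV (s, v))).
  exact: (measurableT_comp mcons (pair1_measurable s)).
pose H s := \int[borel_lebesgue n]_v h (cons_rV (s, v)).
have mH : measurable_fun [set: measurableTypeR R] H.
  exact: (measurable_fun_fubini_tonelli_F (h \o @cons_rV R n) mcons (fun=> h0 _)).
have H0 s : 0 <= H s by apply: integral_ge0 => v _; exact: h0.
transitivity (\int[@lebesgue_measure R]_s ((t ^- n)%:E * H (c ord0 ord0 + t * s)%R)).
  apply: eq_integral => s _; rewrite /H -(IH (fun v => h (cons_rV (_, v))) c')//.
  by apply: eq_integral => v _; rewrite E.
have mphi : measurable_fun [set: measurableTypeR R]
    (fun s : measurableTypeR R => (c ord0 ord0 + t * s)%R : measurableTypeR R).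
  by apply: measurable_funD => //; exact: measurable_funM.
have mHphi := measurableT_comp mH mphi.
transitivity ((t ^- n)%:E * \int[@lebesgue_measure R]_s H (c ord0 ord0 + t * s)%R).
  apply: ge0_integralZl_EFin => //; last by rewrite invr_ge0 exprn_ge0// ltW.
have -> := ge0_integral_affine1 (c ord0 ord0) t0 mH H0.
by rewrite muleA -EFinM exprSr invfM.
Qed.

End cons_integral.

Lemma measurable_subr_rV {R : realType} n (z : 'rV[R]_n) :
  measurable_fun setT (fun x : 'rV[R]_n => `|x - z|).
Proof.
apply: measurableT_comp (@measurable_norm_rV R n) _.
rewrite (_ : (fun x => x - z) = (fun x => - z + 1 *: x)); last first.
  by apply/funext => x; rewrite scale1r addrC.
exact: measurable_affine_rV.
Qed.

(** * Shell weights *)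

Section shell_weight.
Context {R : realType}.

(** The function r^-n min(r/S, S/r)^g for S = e^s; the scale is kept in
    logarithmic form because it is always produced as a logarithm. The value 0
    at r = 0 makes every bound below hold on the diagonal too. *)
Definition shell_weight (n : nat) (g r s : R) : R :=
  if 0 < r then expR (- n%:R * ln r - g * `|ln r - s|) else 0.

Lemma shell_weight_ge0 n g r s : 0 <= shell_weight n g r s.
Proof. by rewrite /shell_weight; case: ifP => // _; exact: expR_ge0. Qed.

Lemma measurable_shell_weight d (T : measurableType d) n (g : R) (r s : T -> R) :
  measurable_fun setT r -> measurable_fun setT s ->
  measurable_fun setT (fun x => shell_weight n g (r x) (s x)).
Proof.
move=> mr ms; have mlr : measurable_fun setT (fun x => ln (r x)).
  exact: measurableT_comp (@measurable_ln R) mr.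
apply: measurable_fun_ifT => //; first exact: measurable_fun_ltr.
apply: measurableT_comp => //; apply: measurable_funB; first exact: measurable_funM.
apply: measurable_funM => //; apply: measurableT_comp => //.
exact: measurable_funB.
Qed.

(** On the k-th shell around radius e^s, inwards or outwards, the weight is at
    most e^(n - g k) r^-n, where r is the radius of a cube containing the shell. *)
Lemma shell_weight_le_cubes n (g s : R) (z x : 'rV[R]_n) : 0 < g ->
  exists k : nat, shell_weight n g `|x - z| s <=
  expR (n%:R - g * k%:R) *
   (expR (- n%:R * (s - k%:R)) * \1_(cube z (expR (s - k%:R))) x +
    expR (- n%:R * (s + k.+1%:R)) * \1_(cube z (expR (s + k.+1%:R))) x).
Proof.
move=> g0; exists (Num.truncn `|ln `|x - z| - s|).
rewrite /shell_weight; case: ifPn => [r0|_]; last first.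
  by rewrite mulr_ge0 ?expR_ge0// addr_ge0// mulr_ge0// expR_ge0.
set t := `|_ - s|; set k := Num.truncn t.
have /andP[kt tk] : k%:R <= t < k.+1%:R by apply: Num.Theory.truncn_itv; exact: normr_ge0.
have gkt : g * k%:R <= g * t by rewrite ler_pM2l.
rewrite -[leLHS]addr0 mulrDr !mulrA -!expRD.
have inE r : ln `|x - z| <= r -> \1_(cube z (expR r)) x = 1 :> R.
  by move=> h; rewrite indicE mem_set// /cube/= -(lnK r0) ler_expR.
have n0 : 0 <= n%:R :> R by [].
have nk : n%:R * k%:R <= n%:R * t by rewrite ler_wpM2l.
have nk1 : n%:R * t <= n%:R * k.+1%:R by rewrite ler_wpM2l// ltW.
rewrite -natr1 in tk nk1 *.
have [rs|rs] := leP (ln `|x - z|) s.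
  have tE : t = s - ln `|x - z| by rewrite /t distrC ger0_norm// subr_ge0.
  rewrite lerD ?mulr_ge0 ?expR_ge0//.
  rewrite inE; last by move: kt; rewrite tE; lra.
  rewrite mulr1 ler_expR; move: gkt nk1; rewrite tE; lra.
have tE : t = ln `|x - z| - s by rewrite /t gtr0_norm// subr_gt0.
rewrite [leLHS]addrC lerD ?mulr_ge0 ?expR_ge0//.
rewrite inE; last by move: tk; rewrite tE; lra.
rewrite mulr1 ler_expR; move: gkt nk; rewrite tE; lra.
Qed.

Local Open Scope ereal_scope.

Lemma nneseries_geometric_le (a z : R) : (0 <= a)%R -> (0 <= z < 1)%R ->
  \sum_(0 <= k <oo) (a * z ^+ k)%:E <= (a / (1 - z))%:E.
Proof.
move=> a0 /andP[z0 z1]; have z1' : (0 < 1 - z)%R by rewrite subr_gt0.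
have u0 k : 0 <= (a * z ^+ k)%:E by rewrite lee_fin mulr_ge0// exprn_ge0.
apply: lime_le; first exact: is_cvg_nneseries.
apply: nearW => N; rewrite sumEFin lee_fin -mulr_sumr ler_wpM2l//.
rewrite -(ler_pM2r z1') mulVf ?gt_eqF//.
rewrite (_ : _ * _ = 1 - z ^+ N)%R; last first.
  rewrite big_mkord mulrC; have := subrXX 1 z N; rewrite expr1n => ->.
  by congr (_ * _)%R; apply: eq_bigr => i _; rewrite expr1n mul1r.
by rewrite gerBl exprn_ge0.
Qed.

Lemma integral_cube_indic n (c : R) (z : 'rV[R]_n) (r : R) : (0 <= c)%R -> (0 <= r)%R ->
  \int[borel_lebesgue n]_x (c * \1_(cube z r) x)%:E = (c * (2 * r) ^+ n)%:E.
Proof.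
move=> c0 r0; under eq_integral do rewrite EFinM.
rewrite ge0_integralZl_EFin//; last first.
  by apply/measurable_EFinP; apply: measurable_indic; exact: measurable_cube.
rewrite integral_indic// ?setIT; last exact: measurable_cube.
by rewrite EFinM; congr (_ * _); exact: borel_lebesgue_cube.
Qed.

(** The bound does not depend on the scale s: each shell contributes a term of
    a geometric series of ratio e^-g. *)
Lemma integral_shell_weight n (g : R) : (0 < g)%R ->
  exists C : R, (0 < C)%R /\ forall (z : 'rV[R]_n) (s : R),
  \int[borel_lebesgue n]_x (shell_weight n g `|x - z| s)%:E <= C%:E.
Proof.
move=> g0; pose a : R := (expR n%:R * (2 ^+ n + 2 ^+ n))%R.
have a0 : (0 < a)%R by rewrite mulr_gt0 ?expR_gt0// addr_gt0// exprn_gt0.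
have eg : (0 <= expR (- g) < 1)%R by rewrite expR_ge0/= -expR0 ltr_expR oppr_lt0.
exists (a / (1 - expR (- g)))%R; split.
  by rewrite divr_gt0// subr_gt0; case/andP: eg.
move=> z s.
pose f (k : nat) (r : R) (x : 'rV[R]_n) : R :=
  (expR (n%:R - g * k%:R) * expR (- n%:R * r) * \1_(cube z (expR r)) x)%R.
have f0 k r x : (0 <= f k r x)%R by rewrite !mulr_ge0// expR_ge0.
have mf k r : measurable_fun setT (fun x => (f k r x)%:E).
  apply/measurable_EFinP; apply: measurable_funM => //.
  by apply: measurable_indic; exact: measurable_cube.
have If k r : \int[borel_lebesgue n]_x (f k r x)%:E =
    (expR (n%:R - g * k%:R) * 2 ^+ n)%:E.
  rewrite integral_cube_indic ?mulr_ge0 ?expR_ge0//.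
  rewrite exprMn -mulrA; congr ((_ * _)%:E).
  by rewrite mulrCA -expRM_natl mulNr expRN mulVf ?mulr1// gt_eqF ?expR_gt0.
pose h (k : nat) x := (f k (s - k%:R)%R x)%:E + (f k (s + k.+1%:R)%R x)%:E.
have h0 k x : 0 <= h k x by rewrite adde_ge0// lee_fin.
have mh k : measurable_fun setT (h k) by exact: emeasurable_funD.
apply: (@le_trans _ _ (\int[borel_lebesgue n]_x \sum_(0 <= k <oo) h k x)).
  apply: ge0_le_integral => //.
  - by move=> x _; rewrite lee_fin shell_weight_ge0.
  - apply/measurable_EFinP; apply: measurable_shell_weight => //.
    exact: measurable_subr_rV.
  - by apply: ge0_emeasurable_sum.
  - move=> x _; have [k hk] := shell_weight_le_cubes s z x g0.
    apply: (@le_trans _ _ (h k x)).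
      by rewrite /h -EFinD lee_fin (le_trans hk)// mulrDr !mulrA.
    have := @nneseries_lim_ge R (h ^~ x) xpredT 0%N k.+1 (fun i _ _ => h0 i x).
    by apply: le_trans; rewrite big_nat_recr//= leeDr// sume_ge0.
rewrite integral_nneseries//.
apply: le_trans (nneseries_geometric_le (ltW a0) eg).
apply: lee_nneseries => [k _ _|k _]; first by apply: integral_ge0 => x _; exact: h0.
rewrite /h ge0_integralD//; try (by move=> x _; rewrite lee_fin).
rewrite !If -EFinD lee_fin -mulrDr /a mulrAC expRD ler_wpM2r ?addr_ge0 ?exprn_ge0//.
by rewrite -mulNr [(- g * _)%R]mulrC expRM_natl.
Qed.

End shell_weight.

(** * The weighted integral operator *)

(** The quantitative consequences of the hypotheses on the exponents that the
    operator bound depends on: al is the gain of integrability, V0 > 0 bounds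
    n/q from below, U1 < n bounds n/p from above (this is p_- > 1), and ep > 0
    bounds a + n/q from below. In [osc_radial], K is the rate at which the
    oscillation of p may grow with ln (|z|/|x|). *)
Record admissible {R : realType} (n : nat) (P Q : 'rV[R]_n -> R)
    (al a ep L K V0 U1 q : R) : Prop := Admissible {
  dim_gt0 : (0 < n)%N;
  gain_itv : 0 <= al <= 1;
  V0_gt0 : 0 < V0;
  U1_lt : U1 < n%:R;
  ep_gt0 : 0 < ep;
  L_ge0 : 0 <= L;
  K_ge0 : 0 <= K;
  measurable_P : measurable_fun setT P;
  measurable_Q : measurable_fun setT Q;
  P_ge1 : forall x, 1 <= P x;
  P_le_Q : forall x, P x <= Q x;
  Q_le : forall x, Q x <= q;
  defect : forall x, n%:R / P x - al = n%:R / Q x;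
  V0_le : forall x, V0 <= n%:R / Q x;
  le_U1 : forall x, n%:R / P x <= U1;
  osc_local : forall x z, 0 < `|x - z| -> `|x - z| <= `|x| / 2 ->
    `|n%:R / P x - n%:R / P z| * `|ln `|x - z| | <= L /\
    `|n%:R / P x - n%:R / P z| * `|ln `|x| | <= L;
  osc_radial : forall x z, 0 < `|x| -> `|x| <= `|z| ->
    `|P x - P z| * `|ln `|x| | <= L + K * (ln `|z| - ln `|x|) /\
    a * ln `|x| + n%:R / Q x * ln `|x| - (a * ln `|z| + n%:R / Q z * ln `|z|) <=
      L + ep * (ln `|x| - ln `|z|)
}.

(** In the second branch, off the diagonal, |x-z| is comparable with |z|, hence the
    factor |z|^(1-n) instead of |x-z|^(1-n). *)
Definition critical_kernel {R : realType} n (al a : R) (x z : 'rV[R]_n) : R :=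
  if (0 < `|x - z|) && (`|x - z| <= `|x| / 2) then
    expR ((al - 1) * ln `|x| + (1 - n%:R) * ln `|x - z|)
  else if (0 < `|x|) && (`|x| <= `|z|) then
    expR (a * ln `|x| + (al - a - n%:R) * ln `|z|)
  else 0.

Lemma critical_kernel_ge0 {R : realType} n (al a : R) (x z : 'rV[R]_n) :
  0 <= critical_kernel al a x z.
Proof.
rewrite /critical_kernel; case: ifP => _; first exact: expR_ge0.
by case: ifP => _; first exact: expR_ge0.
Qed.

Lemma shell_weight_ge {R : realType} n (g g' r s k : R) : 0 < r -> g <= g' ->
  k <= - n%:R * ln r - g' * `|ln r - s| -> expR k <= shell_weight n g r s.
Proof.
move=> r0 gg h; rewrite /shell_weight r0 ler_expR (le_trans h)//.
by rewrite lerD2l lerN2 ler_wpM2r.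
Qed.

Lemma le_sum3 {R : realDomainType} (x a b c : R) : 0 <= a -> 0 <= b -> 0 <= c ->
  x <= a \/ x <= b \/ x <= c -> x <= a + b + c.
Proof. by move=> a0 b0 c0 [|[]]; lra. Qed.

Lemma le_sum2 {R : realDomainType} (x a b : R) : 0 <= a -> 0 <= b ->
  x <= a \/ x <= b -> x <= a + b.
Proof. by move=> a0 b0 []; lra. Qed.

(** The two logarithmic estimates combined. The exponent g does not depend on
    the smallness e^-E, which matters because E will be chosen in terms of the
    integral of [shell_weight] with that g. *)
Lemma kernel_dichotomy {R : realType} (n : nat) (P Q : 'rV[R]_n -> R)
    (al a ep L K V0 U1 q : R) (H : admissible P Q al a ep L K V0 U1 q) :
  exists d : R, 0 < d /\ exists g : R, 0 < g /\ forall E, 0 <= E ->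
  exists LA Lc LC : R, forall (x z : 'rV[R]_n) (F G : R),
  0 < F -> 0 <= G -> 0 < `|x| ->
  - (n%:R / Q x) * ln `|x| - d * `|ln `|x| | < ln F ->
  critical_kernel al a x z * G <=
   expR (- E) * F * (shell_weight n g `|x - z| (Order.min ((LA - ln F) / (n%:R / Q x)) (ln `|x|))
      + shell_weight n g `|z| (ln `|x|) + G `^ P z) +
   expR LC * F `^ (1 - Q x) * (G `^ P z *
     (shell_weight n g `|x - z| (Order.min ((- Lc - ln G) / (n%:R / P z)) (ln `|z|))
      + shell_weight n g `|x| (ln `|z|))).
Proof.
case: H => n0 al01 V0_gt0 U1_lt ep0 L0 K0 mP mQ P_ge1 P_le_Q Q_le defect V0_le le_U1 osc_local osc_radial.
(* d K <= ep / 2 is what the Hardy part requires. *)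
pose d : R := ep / 2 / (K + 1).
have d_gt0 : 0 < d by rewrite !divr_gt0// ltr_wpDl.
have dK : d * K <= ep / 2.
  rewrite /d mulrAC ler_pdivrMr ?ltr_wpDl// ler_wpM2l//; last by rewrite lerDl.
  by rewrite divr_ge0// ltW.
clearbody d; exists d; split => //.
have P_gt0 x : 0 < P x by exact: lt_le_trans (P_ge1 x).
have Q_gt0 x : 0 < Q x by exact: lt_le_trans (P_le_Q x).
have nR0 : 0 < n%:R :> R by rewrite ltr0n.
have [g0 [g00 hloc]] := local_log_estimate nR0 al01 V0_gt0 U1_lt d_gt0 L0 (@ler01 R).
pose g := Order.min g0 (ep / 2).
have gg0 : g <= g0 by rewrite ge_min lexx.
have gep : g <= ep / 2 by rewrite ge_min lexx orbT.
exists g; split; first by rewrite lt_min g00 divr_gt0.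
move=> E E0; have [LA [Lc [LC1 {}hloc]]] := hloc E E0.
have [LC2 hhar] := hardy_log_estimate n%:R al a q ep0 d_gt0 K0 dK L0 E0.
exists LA, Lc, (Order.max LC1 LC2) => x z F G F0 G0 x0 Tx.
set LC := Order.max _ _.
have LC1' : LC1 <= LC by rewrite le_max lexx.
have LC2' : LC2 <= LC by rewrite le_max lexx orbT.
have W0 := @shell_weight_ge0 R n.
set w1 := shell_weight n g `|x - z| (Order.min ((LA - ln F) / _) _).
set w2 := shell_weight n g `|z| _.
set w3 := shell_weight n g `|x - z| (Order.min ((- Lc - ln G) / _) _).
set w4 := shell_weight n g `|x| _.
have w10 : 0 <= w1 by exact: W0.
have w20 : 0 <= w2 by exact: W0.
have w30 : 0 <= w3 by exact: W0.
have w40 : 0 <= w4 by exact: W0.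
have GP0 := powR_ge0 G (P z).
have F0' := ltW F0.
have RHS0 : 0 <= expR (- E) * F * (w1 + w2 + G `^ P z) +
    expR LC * F `^ (1 - Q x) * (G `^ P z * (w3 + w4)).
  by rewrite !(addr_ge0, mulr_ge0)// ?expR_ge0 ?powR_ge0.
move: G0; rewrite le_eqVlt => /predU1P[G0|G0]; first by rewrite -{1}G0 mulr0.
have bound1 k t : k + ln G <= - E + ln F + t ->
    expR t <= w1 \/ expR t <= w2 \/ expR t <= G `^ P z ->
    expR k * G <= expR (- E) * F * (w1 + w2 + G `^ P z) +
      expR LC * F `^ (1 - Q x) * (G `^ P z * (w3 + w4)).
  move=> h1 h2; have {}h1 : expR k * G <= expR (- E) * F * expR t.
    by rewrite -(lnK G0) -[X in _ * X * _](lnK F0) -!expRD ler_expR.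
  apply: (le_trans h1); rewrite -[leLHS]addr0; apply: lerD; last first.
    by rewrite !(addr_ge0, mulr_ge0)// ?expR_ge0 ?powR_ge0.
  rewrite ler_wpM2l ?mulr_ge0 ?expR_ge0//.
  exact: le_sum3.
have bound2 k t C : C <= LC -> k + ln G <= C + (ln F - ln F * Q x + ln G * P z) + t ->
    expR t <= w3 \/ expR t <= w4 ->
    expR k * G <= expR (- E) * F * (w1 + w2 + G `^ P z) +
      expR LC * F `^ (1 - Q x) * (G `^ P z * (w3 + w4)).
  move=> CL h1 h2.
  have {}h1 : expR k * G <= expR LC * F `^ (1 - Q x) * (G `^ P z * expR t).
    rewrite /powR !gt_eqF// -[X in _ * X <= _](lnK G0) -!expRD ler_expR.
    by move: h1 CL; clear; lra.
  apply: (le_trans h1); rewrite -[leLHS]add0r; apply: lerD.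
    by rewrite !(addr_ge0, mulr_ge0)// ?expR_ge0 ?powR_ge0.
  rewrite ler_wpM2l ?mulr_ge0 ?expR_ge0 ?powR_ge0// ler_wpM2l//.
  exact: le_sum2.
have GP : expR (ln G * P z) = G `^ P z by rewrite /powR gt_eqF// mulrC.
have Px0 := P_gt0 x; have Pz0 := P_gt0 z; have Qx0 := Q_gt0 x.
have PU : P z * (n%:R / P z) = n%:R by rewrite mulrC divfK// gt_eqF.
have QV : Q x * (n%:R / P x - al) = n%:R by rewrite defect mulrC divfK// gt_eqF.
rewrite /critical_kernel; case: ifPn => [/andP[xz0 xz]|_].
  have [osc1 osc2] := osc_local x z xz0 xz.
  have xzx : `|x - z| <= `|x| by move: xz x0; clear; lra.
  have zx : `|z| <= `|x| + `|x - z|.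
    by rewrite -[in leLHS](subKr x z); apply: le_trans (ler_normB _ _) _.
  have xz' : `|x| <= `|z| + `|x - z|.
    by rewrite -[in leLHS](subrK z x) addrC; apply: le_trans (ler_normD _ _) _.
  have z0 : 0 < `|z| by move: xz xz' x0; clear; lra.
  (* |z| is between |x|/2 and 3|x|/2, hence the bound 1 on |ln|x| - ln|z||. *)
  have e1 : 2 <= expR 1 :> R.
    exact: (@expR_ge1Dx R 1).
  have XZ : `|ln `|x| - ln `|z| | <= 1.
    rewrite -ln_div ?posrE// ler_norml; apply/andP; split.
      rewrite -ler_expR lnK ?posrE ?divr_gt0// expRN ler_pdivlMr// ler_pdivrMl ?expR_gt0//.
      have : 2 * `|x| <= expR 1 * `|x| by rewrite ler_wpM2r// ltW.
      by move: zx xz x0; clear; lra.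
    rewrite -ler_expR lnK ?posrE ?divr_gt0// ler_pdivrMr//.
    have : 2 * `|z| <= expR 1 * `|z| by rewrite ler_wpM2r// ltW.
    by move: xz' xz z0; clear; lra.
  have := hloc (ln `|x|) (ln `|x - z|) (ln `|z|) (n%:R / P x) (n%:R / P z) (P z) (Q x) (ln F) (ln G).
  rewrite !defect => /(_ (ltW Pz0) (ltW Qx0) PU).
  have QV' : Q x * (n%:R / Q x) = n%:R by rewrite -defect.
  move=> /(_ QV' (V0_le x) (V0_le z) (le_U1 z) (le_U1 x) osc1 osc2).
  have lxz : ln `|x - z| <= ln `|x| by rewrite ler_ln ?posrE.
  move=> /(_ lxz XZ Tx) [h|h|h].
  - apply: (bound1 _ (- n%:R * ln `|x - z| - g0 * `|ln `|x - z| - Order.min ((LA - ln F) / (n%:R / Q x)) (ln `|x|)|)).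
      by move: h; rewrite mulNr; clear; lra.
    by left; apply: (shell_weight_ge xz0 gg0).
  - apply: (bound1 _ (ln G * P z)); first by move: h; clear; lra.
    by right; right; rewrite GP.
  - apply: (bound2 _ (- n%:R * ln `|x - z| - g0 * `|ln `|x - z| - Order.min ((- Lc - ln G) / (n%:R / P z)) (ln `|z|)|) _ LC1').
      by move: h; rewrite mulNr; clear; lra.
    by left; apply: (shell_weight_ge xz0 gg0).
case: ifPn => [/andP[_ xz]|_]; last by rewrite mul0r.
have [osc1 osc2] := osc_radial x z x0 xz.
have z0 : 0 < `|z| by exact: lt_le_trans xz.
have lxz : ln `|x| <= ln `|z| by rewrite ler_ln ?posrE.
have := hhar (ln `|x|) (ln `|z|) (n%:R / P x) (n%:R / P z) (P x) (P z) (Q x) (ln F) (ln G).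
rewrite !defect => /(_ (P_ge1 x) (P_le_Q x) (Q_le x) (P_ge1 z)).
have Pzq : P z <= q by exact: le_trans (P_le_Q z) (Q_le z).
have QV' : Q x * (n%:R / Q x) = n%:R by rewrite -defect.
move=> /(_ Pzq PU QV' lxz osc1 osc2 Tx) [h|h|h].
- apply: (bound1 _ (- n%:R * ln `|z| - ep / 2 * `|ln `|z| - ln `|x| |)).
    by move: h; rewrite mulNr; clear; lra.
  by right; left; apply: (shell_weight_ge z0 gep).
- apply: (bound1 _ (ln G * P z)); first by move: h; clear; lra.
  by right; right; rewrite GP.
- apply: (bound2 _ (- n%:R * ln `|x| - ep / 2 * `|ln `|x| - ln `|z| |) _ LC2').
    by move: h; rewrite mulNr; clear; lra.
  by right; apply: (shell_weight_ge x0 gep).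
Qed.

Lemma measurable_powR_fun {R : realType} d (T : measurableType d) (f g : T -> R) :
  measurable_fun setT f -> measurable_fun setT g ->
  measurable_fun setT (fun x => f x `^ g x).
Proof.
move=> mf mg; rewrite /powR; apply: measurable_fun_ifT.
- exact: measurable_fun_eqr.
- apply: (measurableT_comp (f := fun b : bool => b%:R : R)) => //.
  exact: measurable_fun_eqr.
- apply: measurableT_comp => //; apply: measurable_funM => //.
  exact: measurableT_comp (@measurable_ln R) mf.
Qed.

Lemma measurable_norm_sub {R : realType} n :
  measurable_fun setT (fun xz : 'rV[R]_n * 'rV[R]_n => `|xz.1 - xz.2|).
Proof.
apply: measurableT_comp (@measurable_norm_rV R n) _.
apply: measurable_fun_rV => i.
rewrite (_ : _ \o _ = (fun xz => coord_rV i xz.1 - coord_rV i xz.2)); last first.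
  by apply/funext => v; rewrite /coord_rV /= !mxE.
apply: measurable_funB.
  exact: measurableT_comp (measurable_coord_rV i) measurable_fst.
exact: measurableT_comp (measurable_coord_rV i) measurable_snd.
Qed.

Lemma measurable_critical_kernel {R : realType} n (al a : R) (x : 'rV[R]_n) :
  measurable_fun setT (critical_kernel al a x).
Proof.
have mxz : measurable_fun setT (fun z : 'rV[R]_n => `|x - z|).
  by under eq_fun do rewrite distrC; exact: measurable_subr_rV.
have mn := @measurable_norm_rV R n.
apply: measurable_fun_ifT.
- apply: measurable_and; first exact: measurable_fun_ltr.
  exact: measurable_fun_ler.
- apply: measurableT_comp => //; apply: measurable_funD => //.
  apply: measurable_funM => //; exact: measurableT_comp (@measurable_ln R) mxz.
apply: measurable_fun_ifT => //.
- by apply: measurable_and => //; exact: measurable_fun_ler.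
- apply: measurableT_comp => //; apply: measurable_funD => //.
  apply: measurable_funM => //; exact: measurableT_comp (@measurable_ln R) mn.
Qed.

Local Open Scope ereal_scope.

(** With E such that e^-E (2 Cg + 1) = 1/2, where Cg bounds the integrals of the
    shell weights, the negligible terms of [kernel_dichotomy] integrate to at most
    F x / 2 and can be absorbed. The remaining term is M, whose double integral
    is computed in the other order: for fixed z the weights integrate to at most
    2 Cg, and the integral of G^P is at most 1. *)
Lemma modular_bound {R : realType} (n : nat) (P Q : 'rV[R]_n -> R)
    (al a ep L K V0 U1 q : R) (H : admissible P Q al a ep L K V0 U1 q) :
  exists C : R, (0 < C)%R /\ forall F G : 'rV[R]_n -> R,
    measurable_fun setT F -> measurable_fun setT G ->
    (forall x, 0 <= F x)%R -> (forall x, 0 <= G x)%R -> F 0%R = 0%R ->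
    (forall x, x != 0%R ->
      (F x)%:E <= \int[borel_lebesgue n]_z (critical_kernel al a x z * G z)%:E) ->
    \int[borel_lebesgue n]_z (G z `^ P z)%:E <= 1 ->
    \int[borel_lebesgue n]_x (F x `^ Q x)%:E <= C%:E.
Proof.
have [d [d0 [g [g0 Hk]]]] := kernel_dichotomy H.
case: H => n0 _ V0_gt0 _ _ _ _ mP mQ P_ge1 P_le_Q _ _ V0_le _ _ _.
have [Cg [Cg0 HCg]] := @integral_shell_weight R n g g0.
have [Cd [Cd0 HCd]] := @integral_shell_weight R n d d0.
have HCg0 s : \int[borel_lebesgue n]_x (shell_weight n g `|x| s)%:E <= Cg%:E.
  apply: le_trans (HCg 0%R s); rewrite le_eqVlt; apply/orP; left; apply/eqP.
  by apply: eq_integral => x _; rewrite subr0.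
have HCd0 s : \int[borel_lebesgue n]_x (shell_weight n d `|x| s)%:E <= Cd%:E.
  apply: le_trans (HCd 0%R s); rewrite le_eqVlt; apply/orP; left; apply/eqP.
  by apply: eq_integral => x _; rewrite subr0.
have CC0 : (0 < 2 * (2 * Cg + 1))%R by rewrite mulr_gt0// addr_gt0// mulr_gt0.
have E0 : (0 <= ln (2 * (2 * Cg + 1)))%R.
  by apply: ln_ge0; rewrite mulrDr mulr1 mulrA; have : (0 < 2 * 2 * Cg)%R; [rewrite !mulr_gt0|lra].
have [LA [Lc [LC {}Hk]]] := Hk _ E0.
rewrite expRN lnK// in Hk.
have Q_gt0 x : (0 < Q x)%R by rewrite (lt_le_trans _ (P_le_Q x))// (lt_le_trans _ (P_ge1 x)).
pose C := (Cd + 2 * expR LC * (2 * Cg))%R.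
exists C; split; first by rewrite addr_gt0// !mulr_gt0// expR_gt0.
move=> F G mF mG F0 G0 F00 HF HG.
have mn := @measurable_norm_rV R n.
have mln : measurable_fun setT (fun x : 'rV[R]_n => ln `|x|) by exact: measurableT_comp (@measurable_ln R) mn.
have mlnG : measurable_fun setT (fun x => ln (G x)) by exact: measurableT_comp (@measurable_ln R) mG.
have mGP : measurable_fun setT (fun z => G z `^ P z)%R by exact: measurable_powR_fun.
have GP0 z : (0 <= G z `^ P z)%R by exact: powR_ge0.
have W0 := @shell_weight_ge0 R n.
pose w1 (x z : 'rV[R]_n) : R := (shell_weight n g `|x - z| (Order.min ((LA - ln (F x)) / (n%:R / Q x)) (ln `|x|)))%R.
pose w2 (x z : 'rV[R]_n) : R := shell_weight n g `|z| (ln `|x|).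
pose w3 (x z : 'rV[R]_n) : R := (shell_weight n g `|x - z| (Order.min ((- Lc - ln (G z)) / (n%:R / P z)) (ln `|z|)))%R.
pose w4 (x z : 'rV[R]_n) : R := shell_weight n g `|x| (ln `|z|).
have w10 x z : (0 <= w1 x z)%R by exact: W0.
have w20 x z : (0 <= w2 x z)%R by exact: W0.
have w30 x z : (0 <= w3 x z)%R by exact: W0.
have w40 x z : (0 <= w4 x z)%R by exact: W0.
pose M (xz : 'rV[R]_n * 'rV[R]_n) := (G xz.2 `^ P xz.2 * (w3 xz.1 xz.2 + w4 xz.1 xz.2))%R.
have M0 xz : (0 <= M xz)%R by rewrite mulr_ge0// addr_ge0.
have mln2 : measurable_fun setT (fun xz : 'rV[R]_n * 'rV[R]_n => ln `|xz.2|).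
  exact: measurableT_comp mln measurable_snd.
have mM : measurable_fun setT (fun xz => (M xz)%:E).
  apply/measurable_EFinP; apply: measurable_funM.
    exact: measurableT_comp mGP measurable_snd.
  apply: measurable_funD; apply: measurable_shell_weight => //.
  - exact: measurable_norm_sub.
  - apply: measurable_minr => //.
    have : measurable_fun setT (fun z => (- Lc - ln (G z)) / (n%:R / P z))%R.
      apply: measurable_funM; first exact: measurable_funB.
      have -> : (fun x => (n%:R / P x)^-1)%R = (fun x => P x * n%:R^-1)%R.
        by apply/funext => x; rewrite invfM invrK mulrC.
      exact: measurable_funM.
    by move/measurableT_comp; apply; exact: measurable_snd.
  - exact: measurableT_comp mn measurable_fst.
pose J x := \int[borel_lebesgue n]_z (M (x, z))%:E.
have J0 x : 0 <= J x by apply: integral_ge0 => z _; rewrite lee_fin.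
have mJ : measurable_fun setT J.
  exact: (measurable_fun_fubini_tonelli_F (fun xz => (M xz)%:E) mM).
have IJ : \int[borel_lebesgue n]_x J x <= (2 * Cg)%:E.
  have -> : \int[borel_lebesgue n]_x J x =
      \int[borel_lebesgue n]_z \int[borel_lebesgue n]_x (M (x, z))%:E.
    exact: (fubini_tonelli (fun xz => (M xz)%:E) mM).
  apply: (@le_trans _ _ (\int[borel_lebesgue n]_z ((2 * Cg)%:E * (G z `^ P z)%:E))).
    apply: ge0_le_integral; first exact: measurableT.
    - by move=> z _; apply: integral_ge0 => x _; rewrite lee_fin.
    - exact: (measurable_fun_fubini_tonelli_G (fun xz => (M xz)%:E) mM).
    - by apply: measurable_funeM; exact/measurable_EFinP.
    move=> z _.
    have m3 : measurable_fun setT (fun x => (w3 x z)%:E).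
      apply/measurable_EFinP; apply: measurable_shell_weight => //.
      exact: measurable_subr_rV.
    have m4 : measurable_fun setT (fun x => (w4 x z)%:E).
      by apply/measurable_EFinP; apply: measurable_shell_weight.
    rewrite (_ : \int[_]_x _ = (G z `^ P z)%:E *
        \int[borel_lebesgue n]_x ((w3 x z)%:E + (w4 x z)%:E)); last first.
      under eq_integral do rewrite /M /= EFinM EFinD.
      apply: ge0_integralZl_EFin => //; last exact: emeasurable_funD.
      by move=> x _; rewrite -EFinD lee_fin addr_ge0.
    rewrite muleC lee_wpmul2r// ?lee_fin// ge0_integralD//;
      try (by move=> x _; rewrite lee_fin).
    rewrite mulrDl mul1r EFinD; apply: leeD; first exact: HCg.
    exact: HCg0.
  rewrite ge0_integralZl_EFin//; last 3 first.
  - by move=> z _; rewrite lee_fin.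
  - exact/measurable_EFinP.
  - by rewrite mulr_ge0// ltW.
  by rewrite -[leRHS]mule1 lee_wpmul2l// lee_fin mulr_ge0// ltW.
have key x : (F x `^ Q x)%:E <=
    (shell_weight n d `|x| 0)%:E + (2 * expR LC)%:E * J x.
  have rhs0 : 0 <= (2 * expR LC)%:E * J x by rewrite mule_ge0// lee_fin mulr_ge0// expR_ge0.
  have [Fx0|Fx0] := eqVneq (F x) 0%R.
    by rewrite Fx0 powR0 ?gt_eqF// adde_ge0// lee_fin.
  have Fx : (0 < F x)%R by rewrite lt0r Fx0 F0.
  have xn0 : x != 0%R by apply: contra_neq Fx0 => ->.
  have x0 : (0 < `|x|)%R by rewrite normr_gt0.
  (* Below this threshold F^Q is at most the weight centred at scale 1. *)
  have [Tx|Tx] := leP (ln (F x)) (- (n%:R / Q x) * ln `|x| - d * `|ln `|x| |)%R.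
    rewrite -[leLHS]adde0; apply: leeD => //.
    rewrite lee_fin /powR gt_eqF// /shell_weight x0 ler_expR subr0.
    have := ler_wpM2l (ltW (Q_gt0 x)) Tx.
    rewrite mulrDr (_ : Q x * (- (n%:R / Q x) * _) = - n%:R * ln `|x|)%R; last first.
      by field; rewrite gt_eqF.
    move=> /le_trans; apply; rewrite lerD2l mulrN lerN2.
    by rewrite ler_peMl ?mulr_ge0 ?(ltW d0)// (le_trans (P_ge1 x)).
  have c0 : (0 <= (2 * (2 * Cg + 1))^-1 * F x)%R by rewrite mulr_ge0// invr_ge0 ltW.
  have e0 : (0 <= expR LC * F x `^ (1 - Q x))%R by rewrite mulr_ge0 ?expR_ge0 ?powR_ge0.
  have m1 : measurable_fun setT (fun z => (w1 x z)%:E).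
    apply/measurable_EFinP; apply: measurable_shell_weight => //.
    by under eq_fun do rewrite distrC; exact: measurable_subr_rV.
  have m2 : measurable_fun setT (fun z => (w2 x z)%:E).
    by apply/measurable_EFinP; apply: measurable_shell_weight.
  have mE : measurable_fun setT (fun z => (w1 x z)%:E + (w2 x z)%:E + (G z `^ P z)%:E).
    by apply: emeasurable_funD; [exact: emeasurable_funD|exact/measurable_EFinP].
  have E_ge0 z : 0 <= (w1 x z)%:E + (w2 x z)%:E + (G z `^ P z)%:E.
    by rewrite -!EFinD lee_fin !addr_ge0.
  have mMx : measurable_fun setT (fun z => (M (x, z))%:E).
    exact: (measurableT_comp mM (pair1_measurable x)).
  have : (F x)%:E <= (F x / 2)%:E + (expR LC * F x `^ (1 - Q x))%:E * J x.
    apply: (le_trans (HF x xn0)).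
    apply: (@le_trans _ _ (\int[borel_lebesgue n]_z
      (((2 * (2 * Cg + 1))^-1 * F x)%:E * ((w1 x z)%:E + (w2 x z)%:E + (G z `^ P z)%:E)
       + (expR LC * F x `^ (1 - Q x))%:E * (M (x, z))%:E))).
      apply: ge0_le_integral; first exact: measurableT.
      - by move=> z _; rewrite lee_fin mulr_ge0// critical_kernel_ge0.
      - apply/measurable_EFinP; apply: measurable_funM => //.
        exact: measurable_critical_kernel.
      - by apply: emeasurable_funD; exact: measurable_funeM.
      - move=> z _; rewrite -!EFinD lee_fin; exact: Hk.
    rewrite ge0_integralD//; last 4 first.
    - by move=> z _; rewrite mule_ge0// lee_fin.
    - exact: measurable_funeM.
    - by move=> z _; rewrite mule_ge0// lee_fin.
    - exact: measurable_funeM.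
    apply: leeD; last by rewrite ge0_integralZl_EFin// => z _; rewrite lee_fin.
    rewrite ge0_integralZl_EFin//.
    rewrite ge0_integralD//; last 4 first.
    - by move=> z _; rewrite -EFinD lee_fin addr_ge0.
    - exact: emeasurable_funD.
    - by move=> z _; rewrite lee_fin.
    - exact/measurable_EFinP.
    rewrite ge0_integralD//; try (by move=> z _; rewrite lee_fin).
    have h1 : \int[borel_lebesgue n]_z (w1 x z)%:E <= Cg%:E.
      by under eq_integral do rewrite /w1 distrC; exact: HCg.
    have h2 : \int[borel_lebesgue n]_z (w2 x z)%:E <= Cg%:E.
      exact: HCg0.
    apply: (@le_trans _ _ (((2 * (2 * Cg + 1))^-1 * F x)%:E * (2 * Cg + 1)%:E)).
      rewrite lee_wpmul2l ?lee_fin// EFinD leeD// mulrDl mul1r EFinD.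
      exact: leeD.
    rewrite -EFinM lee_fin le_eqVlt; apply/orP; left; apply/eqP; field.
    by rewrite gt_eqF// addr_gt0// mulr_gt0.
  have := J0 x; case: (J x) => [r| |]//; last first.
    by move=> _ _; rewrite [X in _ <= _ + X]gt0_muley ?addey ?leey// lte_fin mulr_gt0 ?expR_gt0.
  move=> _; rewrite -!EFinM -!EFinD !lee_fin => h.
  rewrite -[leLHS]add0r lerD ?W0//.
  have FQ : (F x `^ Q x = F x * F x `^ (Q x - 1))%R.
    by rewrite mulr_powRB1// ltW.
  have F1 : (F x `^ (1 - Q x) * F x `^ (Q x - 1) = 1)%R.
    rewrite -powRD; last by rewrite Fx0 implybT.
    by rewrite (_ : 1 - Q x + (Q x - 1) = 0)%R ?powRr0//; ring.
  have := ler_wpM2r (powR_ge0 (F x) (Q x - 1)) h.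
  rewrite FQ (_ : (_ + _) * _ = F x * F x `^ (Q x - 1) / 2 +
      expR LC * r * (F x `^ (1 - Q x) * F x `^ (Q x - 1)))%R; last by field.
  by rewrite F1; lra.
apply: (@le_trans _ _ (\int[borel_lebesgue n]_x
    ((shell_weight n d `|x| 0)%:E + (2 * expR LC)%:E * J x))).
  apply: ge0_le_integral; first exact: measurableT.
  - by move=> x _; rewrite lee_fin powR_ge0.
  - by apply/measurable_EFinP; exact: measurable_powR_fun.
  - apply: emeasurable_funD; last exact: measurable_funeM.
    by apply/measurable_EFinP; apply: measurable_shell_weight.
  - by move=> x _; exact: key.
have e20 : (0 <= 2 * expR LC)%R by rewrite mulr_ge0// expR_ge0.
rewrite ge0_integralD//; last 4 first.
- by move=> x _; rewrite lee_fin.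
- by apply/measurable_EFinP; apply: measurable_shell_weight.
- by move=> x _; rewrite mule_ge0.
- exact: measurable_funeM.
rewrite /C EFinD; apply: leeD.
  exact: HCd0.
by rewrite ge0_integralZl_EFin// [X in _ <= X]EFinM lee_wpmul2l.
Qed.

Local Close Scope ereal_scope.

(** * Representation by the gradient *)

Section directional_derivative.
Context {R : realType} {V : normedModType R}.
Implicit Types (f : V -> R) (x y u v w : V).

Lemma is_derive_line f y v (s : R) : derivable f (s *: v + y) v ->
  is_derive s 1 (fun t : R => f (t *: v + y)) ('D_v f (s *: v + y)).
Proof.
move=> df; pose F t := f (t *: v + y).
have E : (fun h : R => h^-1 *: ((F \o shift s) (h *: 1) - F s)) =
    (fun h => h^-1 *: ((f \o shift (s *: v + y)) (h *: v) - f (s *: v + y))).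
  by apply/funext => h; rewrite /F /= scaler1 scalerDl addrA.
by apply: DeriveDef; rewrite /derivable /derive -/F E.
Qed.

Lemma MVT_line f y v (t : R) : (forall z, derivable f z v) ->
  exists2 s : R, `|s| <= `|t| & f (t *: v + y) - f y = 'D_v f (s *: v + y) * t.
Proof.
move=> df; pose F (t : R) := f (t *: v + y).
have dF (s : R) : is_derive s 1 F ('D_v f (s *: v + y)).
  exact: is_derive_line.
have cF : continuous F.
  by move=> s; apply: differentiable_continuous; apply/derivable1_diffP; exact: ex_derive.
have F0 : f y = F 0 by rewrite /F scale0r add0r.
have mvt p r : p <= r -> exists2 s, s \in `[p, r]%R & F r - F p = 'D_v f (s *: v + y) * (r - p).
  move=> pr; have cFpr : {within `[p, r], continuous F} by exact: continuous_subspaceT.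
  exact: (@MVT_segment R F (fun s => 'D_v f (s *: v + y)) p r pr (fun s _ => dF s) cFpr).
rewrite -/(F t) F0; have [t0|t0] := leP 0 t.
  have [s + ->] := mvt _ _ t0; rewrite in_itv/= => /andP[s0 st].
  by exists s; rewrite ?subr0// !ger0_norm.
have [s + Es] := mvt _ _ (ltW t0); rewrite in_itv/= => /andP[ts s0].
exists s; first by rewrite !ler0_norm ?lerN2// ltW.
by rewrite -[LHS]opprB Es sub0r mulrN opprK.
Qed.

(** Partial derivatives add up to directional derivatives as soon as they are
    continuous: the increment in the direction v is evaluated by the mean value
    theorem at a point that tends to x. *)
Lemma is_derive_add_dir f u v (c : R) x :
  derivable f x u -> (forall y, derivable f y v) -> continuous ('D_v f) ->
  is_derive x (u + c *: v) f ('D_u f x + c * 'D_v f x).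
Proof.
move=> du dv cv.
pose A (h : R) : R := h^-1 *: ((f \o shift x) (h *: u) - f x).
pose B (h : R) : R := h^-1 *: (f ((h * c) *: v + (h *: u + x)) - f (h *: u + x)).
have E : (fun h : R => h^-1 *: ((f \o shift x) (h *: (u + c *: v)) - f x)) = A \+ B.
  apply/funext => h; rewrite /A /B /= -scalerDr; congr (_ *: _).
  rewrite [RHS]addrC subrKA; congr (f _ - _).
  by rewrite scalerDr scalerA addrA [(h * c) *: v + _]addrC.
have cA : A @ 0^' --> 'D_u f x by exact: du.
have cB : B @ 0^' --> c * 'D_v f x.
  apply/cvgrPdist_le => e e0.
  have e'0 : 0 < e / (`|c| + 1) by rewrite divr_gt0// ltr_wpDl.
  have /cvgrPdist_le/(_ _ e'0)/nbhs_ballP[d /= d0 Hd] := cv x.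
  pose M := `|u| + `|c| * `|v| + 1.
  have M0 : 0 < M by rewrite ltr_wpDl// addr_ge0// mulr_ge0.
  near=> h.
  have hn0 : h != 0 by near: h; exact: nbhs_dnbhs_neq.
  have hd : `|h| * M < d.
    rewrite -ltr_pdivlMr//; near: h; apply: dnbhs0_lt; exact: divr_gt0.
  have [s sh Es] := MVT_line (h *: u + x) (h * c) dv.
  have -> : B h = c * 'D_v f (s *: v + (h *: u + x)).
    by rewrite /B Es /GRing.scale /=; field.
  rewrite -mulrBr normrM.
  have : `|'D_v f x - 'D_v f (s *: v + (h *: u + x))| <= e / (`|c| + 1).
    apply: Hd; rewrite -ball_normE /ball_ /= addrA opprD addrCA subrr addr0.
    rewrite normrN; apply: le_lt_trans (ler_normD _ _) _; rewrite !normrZ.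
    apply: le_lt_trans hd.
    have : `|s| * `|v| <= `|h| * (`|c| * `|v|).
      by rewrite mulrA ler_wpM2r// (le_trans sh)// normrM.
    by move: (normr_ge0 h); rewrite /M !mulrDr; lra.
  move=> /(ler_wpM2l (normr_ge0 c)) /le_trans; apply.
  rewrite mulrA ler_pdivrMr ?ltr_wpDl// mulrC ler_wpM2l ?(ltW e0)//.
  by rewrite lerDl.
apply: DeriveDef.
  by rewrite /derivable E; apply: cvgP (cvgD cA cB).
by rewrite /derive E; apply: cvg_lim => //; exact: cvgD cA cB.
Unshelve. all: by end_near.
Qed.

End directional_derivative.

Section ray.
Context {R : realType} {n : nat}.
Implicit Types (f : 'rV[R]_n -> R) (x w : 'rV[R]_n).

Lemma le_coord_enorm x (i : 'I_n) : `|x ord0 i| <= enorm x.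
Proof.
rewrite /enorm -sqrtr_sqr ler_wsqrtr// (bigD1 i)//= lerDl sumr_ge0// => j _.
exact: sqr_ge0.
Qed.

Lemma enorm_ge0 x : 0 <= enorm x. Proof. exact: sqrtr_ge0. Qed.

Lemma norm_le_enorm x : `|x| <= enorm x.
Proof. by rewrite norm_rV_le ?enorm_ge0//; apply/forallP => i; exact: le_coord_enorm. Qed.

Lemma enorm_le_norm x : enorm x <= n%:R * `|x|.
Proof.
rewrite /enorm -(ger0_norm (mulr_ge0 (ler0n _ n) (normr_ge0 x))) -sqrtr_sqr ler_wsqrtr//.
apply: (@le_trans _ _ (\sum_(i < n) `|x| ^+ 2)).
  apply: ler_sum => i _; rewrite -real_normK ?num_real// ler_pXn2r ?nnegrE//.
  exact: le_coord_norm.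
rewrite sumr_const card_ord exprMn -[leLHS]mulr_natl ler_wpM2r ?sqr_ge0// -natrX ler_nat.
by case: n => // m; rewrite expnS expn1 leq_pmull.
Qed.

Lemma smooth_continuous f : smooth f -> continuous f.
Proof. by move=> sf; exact: (sf [::]).1. Qed.

Lemma smooth_partial_continuous f i : smooth f -> continuous (partial i f).
Proof. by move=> sf; exact: (sf [:: i]).1. Qed.

Lemma measurable_enorm : measurable_fun setT (@enorm R n).
Proof.
apply: (measurableT_comp (f := @Num.sqrt R)).
  by apply: continuous_measurable_fun; exact: sqrt_continuous.
by apply: measurable_sum => i; apply: measurable_funX; exact: measurable_coord_rV.
Qed.

Lemma measurable_enorm_gradient f : smooth f ->
  measurable_fun setT (fun x => enorm (gradient f x)).
Proof.
move=> sf; apply: (measurableT_comp measurable_enorm).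
apply: measurable_fun_rV => i.
rewrite (_ : _ \o _ = partial i f); last first.
  by apply/funext => x; rewrite /coord_rV /= mxE.
by apply: continuous_measurable_rV; exact: smooth_partial_continuous.
Qed.

Lemma is_derive_smooth f x w : smooth f ->
  is_derive x w f (\sum_(i < n) w ord0 i * partial i f x).
Proof.
move=> sf; rewrite [w in is_derive _ w](row_sum_delta w).
elim: (index_enum _) => [|i s IH].
  rewrite !big_nil; have E : (fun h : R => h^-1 *: ((f \o shift x) (h *: 0) - f x)) = cst 0.
    by apply/funext => h; rewrite /= scaler0 add0r subrr scaler0.
  by apply: DeriveDef; rewrite /derivable /derive E; [exact: is_cvg_cst|exact: lim_cst].
rewrite !big_cons addrC [X in is_derive _ _ _ X]addrC.
rewrite -(@derive_val _ _ _ _ _ _ _ IH).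
apply: is_derive_add_dir; first exact: ex_derive.
  by move=> y; exact: (sf [::]).2.
exact: smooth_partial_continuous.
Qed.

Lemma smooth_directional_le f x w : smooth f ->
  `|\sum_(i < n) w ord0 i * partial i f x| <= n%:R * `|w| * enorm (gradient f x).
Proof.
move=> sf; apply: le_trans (ler_norm_sum _ _ _) _.
rewrite -mulrA mulr_natl -[X in _ *+ X]card_ord -sumr_const.
apply: ler_sum => i _; rewrite normrM ler_pM// ?le_coord_norm//.
by have := le_coord_enorm (gradient f x) i; rewrite mxE.
Qed.

Lemma compactly_supported_far f : compactly_supported f ->
  exists M : R, forall x, M < `|x| -> f x = 0.
Proof.
move=> /compact_bounded [M [_ HM]]; exists (M + 1) => x Mx.
apply: contrapT => /eqP fx.
have : closure [set x | f x != 0] x by exact: subset_closure.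
have M1 : M < M + 1 by rewrite ltrDl.
by move=> h; have := HM (M + 1) M1 x h; rewrite /= leNgt Mx.
Qed.

(** f vanishes far away on the ray, so f x is minus the integral of the derivative
    of t |-> f (x + t w). *)
Lemma ray_bound f x w : smooth f -> compactly_supported f -> w != 0 ->
  (`|f x|%:E <= \int[@lebesgue_measure R]_t
     ((0 < t)%R%:R * (n%:R * `|w| * enorm (gradient f (x + t *: w))))%:E)%E.
Proof.
move=> sf /compactly_supported_far [M HM] w0.
have w_gt0 : 0 < `|w| by rewrite normr_gt0.
(* At time T the ray has left the support. *)
pose T := (`|M| + `|x| + 1) / `|w|.
have T0 : 0 < T by rewrite divr_gt0// ltr_wpDl// addr_ge0.
pose F (t : R) := f (t *: w + x).
pose dF (t : R) := \sum_(i < n) w ord0 i * partial i f (t *: w + x).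
have FT : F T = 0.
  apply: HM; have : `|T *: w| <= `|T *: w + x| + `|x|.
    by rewrite -[in leLHS](addrK x (T *: w)); exact: ler_normB.
  rewrite normrZ gtr0_norm// divfK ?gt_eqF//; have := ler_norm M; lra.
have isd (t : R) : is_derive t 1 F (dF t).
  have isw := is_derive_smooth (t *: w + x) w sf.
  have <- : 'D_w f (t *: w + x) = dF t by exact: (@derive_val _ _ _ _ _ _ _ isw).
  by apply: is_derive_line; exact: ex_derive.
have cline : continuous (fun t : R => t *: w + x).
  by move=> t; apply: cvgD; [exact: scalel_continuous|exact: cvg_cst].
have cdF : continuous dF.
  move=> t; apply: cvg_big => [|i _]; first exact: add_continuous.
  apply: cvgM; first exact: cvg_cst.
  by apply: (continuous_comp (cline t)); exact: smooth_partial_continuous.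
have cF : continuous F.
  by move=> t; apply: (continuous_comp (cline t)); exact: smooth_continuous.
have FTC : (\int[@lebesgue_measure R]_(t in `[0%R, T]) (dF t)%:E = (F T)%:E - (F 0%R)%:E)%E.
  apply: continuous_FTC2 => //.
  - exact: continuous_subspaceT.
  - split=> [t _||]; first exact: ex_derive.
      by apply: cvg_at_right_filter; exact: cF.
    by apply: cvg_at_left_filter; exact: cF.
  - by move=> t _; rewrite derive1E; exact: derive_val.
have -> : `|f x|%:E = (`|\int[@lebesgue_measure R]_(t in `[0%R, T]) (dF t)%:E|)%E.
  by rewrite FTC FT sub0e abseN /= /F scale0r add0r.
have mdF : measurable_fun [set: R] dF by exact: continuous_measurable_fun.
apply: (le_trans (le_abse_integral _ _ _)) => //.
  by apply/measurable_EFinP; exact: measurable_funTS.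
pose H (t : R) := (0 < t)%R%:R * (n%:R * `|w| * enorm (gradient f (x + t *: w))).
have H0 t : 0 <= H t by rewrite mulr_ge0// mulr_ge0 ?enorm_ge0// mulr_ge0.
have mH : measurable_fun [set: measurableTypeR R] H.
  apply: measurable_funM.
    apply: (measurableT_comp (f := fun b : bool => b%:R : R)) => //.
    exact: measurable_fun_ltr.
  apply: measurable_funM => //.
  apply: (measurableT_comp (measurable_enorm_gradient sf)).
  apply: measurable_fun_rV => i.
  rewrite (_ : _ \o _ = (fun t => x ord0 i + t * w ord0 i)); last first.
    by apply/funext => t; rewrite /coord_rV /= !mxE.
  by apply: measurable_funD => //; exact: measurable_funM.
have mabs : measurable_fun [set: measurableTypeR R] (fun t => `|(dF t)%:E|%E).
  by apply: measurableT_comp => //; exact/measurable_EFinP.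
have mHE : measurable_fun [set: measurableTypeR R] (fun t => (H t)%:E) by exact/measurable_EFinP.
rewrite -integral_itv_obnd_cbnd; last exact: measurable_funTS.
apply: (@le_trans _ _ (\int[@lebesgue_measure R]_(t in `]0%R, T]) (H t)%:E)%E).
  apply: ge0_le_integral => //; [exact: measurable_funTS|exact: measurable_funTS|].
  move=> t; rewrite /= in_itv/= => /andP[t0 _]; rewrite lee_fin /H t0 mul1r.
  by rewrite [x + _]addrC; exact: smooth_directional_le.
apply: ge0_subset_integral => //.
by move=> t _; rewrite lee_fin.
Qed.

End ray.

Section representation.
Context {R : realType} {n : nat}.
Implicit Types (f : 'rV[R]_n -> R) (x z w : 'rV[R]_n).

(** The Riesz kernel |x-z|^(1-n) restricted to |z| >= |x|. *)
Definition outer_riesz x z : R :=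
  if (0 < `|x - z|) && (`|x| <= `|z|) then expR ((1 - n%:R) * ln `|x - z|) else 0.

Lemma outer_riesz_ge0 x z : 0 <= outer_riesz x z.
Proof. by rewrite /outer_riesz; case: ifP => // _; exact: expR_ge0. Qed.

Lemma measurable_outer_riesz x : measurable_fun setT (outer_riesz x).
Proof.
have mxz : measurable_fun setT (fun z : 'rV[R]_n => `|x - z|).
  by under eq_fun do rewrite distrC; exact: measurable_subr_rV.
apply: measurable_fun_ifT => //.
- apply: measurable_and; first exact: measurable_fun_ltr.
  by apply: measurable_fun_ler => //; exact: measurable_norm_rV.
- apply: measurableT_comp => //; apply: measurable_funM => //.
  exact: measurableT_comp (@measurable_ln R) mxz.
Qed.

(** The points z = x + t w with |w - x| <= |x|/2 and t > 0 form a cone with vertex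
    x that points away from the origin, and on it t is comparable with
    |x-z|/|x|. *)
Lemma cone_geometry x z (t : R) : 0 < t -> x != 0 ->
  `|z - x - t *: x| <= t * (`|x| / 2) ->
  [/\ 0 < `|x - z|, `|x| <= `|z| & 2 * `|x - z| / (3 * `|x|) <= t <= 2 * `|x - z| / `|x|].
Proof.
move=> t0 xn0 h; have x0 : 0 < `|x| by rewrite normr_gt0.
have tx : `|t *: x| = t * `|x| by rewrite normrZ gtr0_norm.
have tx0 : 0 < t * `|x| by rewrite mulr_gt0.
have h1 : `|z - x| <= `|z - x - t *: x| + t * `|x|.
  by rewrite -tx -[in leLHS](subrK (t *: x) (z - x)) ler_normD.
have h2 : t * `|x| <= `|z - x - t *: x| + `|z - x|.
  by rewrite -tx -{1}(subKr (z - x) (t *: x)) [leRHS]addrC ler_normB.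
have h3 : (1 + t) * `|x| <= `|z - x - t *: x| + `|z|.
  have -> : (1 + t) * `|x| = `|(1 + t) *: x| by rewrite normrZ gtr0_norm// addr_gt0.
  rewrite (_ : (1 + t) *: x = z - (z - x - t *: x)); last first.
    by rewrite -[z - x - _]addrA -opprD subKr scalerDl scale1r.
  by rewrite [leRHS]addrC ler_normB.
rewrite (distrC x) ler_pdivrMr ?mulr_gt0// ler_pdivlMr//; split; lra.
Qed.

Lemma integral_itv_indic (a b c : R) : 0 <= c -> a <= b ->
  (\int[@lebesgue_measure R]_t (c * \1_(`[a, b]) t)%:E = (c * (b - a))%:E)%E.
Proof.
move=> c0 ab; under eq_integral do rewrite EFinM.
rewrite ge0_integralZl_EFin//; last first.
  by apply/measurable_EFinP; exact: measurable_indic.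
rewrite integral_indic// setIT EFinM; congr (_ * _)%E.
apply: (etrans (lebesgue_measure_itv `[a, b])); rewrite /= lte_fin.
by case: ltgtP ab => // ->; rewrite subrr.
Qed.

Local Open Scope ereal_scope.

(** [ray_bound] is averaged over w in the cube of centre x and radius |x|/2. For
    fixed t the substitution z = x + t w turns the integral over w into t^-n times
    an integral over z; by [cone_geometry] the integral of t^-n over the
    admissible t is then of order |x|^(n-1) |x-z|^(1-n), and the factor
    |w| <= 3|x|/2 together with the measure |x|^n of the cube, by which one
    divides, cancels the powers of |x|. *)
Lemma outer_riesz_bound : (0 < n)%N -> exists C : R, (0 < C)%R /\
  forall f, smooth f -> compactly_supported f -> forall x, x != 0%R ->
  `|f x|%:E <= \int[borel_lebesgue n]_z (C * (outer_riesz x z * enorm (gradient f z)))%:E.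
Proof.
move=> n0; have n0R : (0 < n%:R :> R)%R by rewrite ltr0n.
pose C : R := (2 * n%:R * (3 / 2) ^+ n)%R.
have C0 : (0 < C)%R by rewrite !mulr_gt0// exprn_gt0// divr_gt0.
exists C; split => // f sf cf x xn0.
have x0 : (0 < `|x|)%R by rewrite normr_gt0.
pose g z := enorm (gradient f z).
have g0 z : (0 <= g z)%R by exact: enorm_ge0.
have mg : measurable_fun setT g by exact: measurable_enorm_gradient.
pose c1 : R := (n%:R * (3 / 2 * `|x|))%R.
have c10 : (0 <= c1)%R by rewrite !mulr_ge0.
pose A w : R := (`|w - x| <= `|x| / 2)%R%:R.
have A0 w : (0 <= A w)%R by [].
have mbool d (T : measurableType d) (b : T -> bool) : measurable_fun setT b ->
    measurable_fun setT (fun u => (b u)%:R : R).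
  by move=> mb; exact: (measurableT_comp (f := fun b : bool => b%:R : R)).
have mA : measurable_fun setT A.
  by apply: mbool; apply: measurable_fun_ler => //; exact: measurable_subr_rV.
pose h (wt : 'rV[R]_n * measurableTypeR R) : R :=
  (A wt.1 * ((0 < wt.2)%R%:R * (c1 * g (x + wt.2 *: wt.1))))%R.
have h0 wt : (0 <= h wt)%R by rewrite !mulr_ge0.
have mrayT : measurable_fun [set: 'rV[R]_n * measurableTypeR R] (fun wt => x + wt.2 *: wt.1)%R.
  apply: measurable_fun_rV => i.
  rewrite (_ : _ \o _ = (fun wt => x ord0 i + wt.2 * coord_rV i wt.1)%R); last first.
    by apply/funext => t; rewrite /coord_rV /= !mxE.
  apply: measurable_funD => //; apply: measurable_funM => //.
  exact: measurableT_comp (measurable_coord_rV i) measurable_fst.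
have mh : measurable_fun setT (fun wt => (h wt)%:E).
  apply/measurable_EFinP; apply: measurable_funM.
    exact: measurableT_comp mA measurable_fst.
  apply: measurable_funM; first by apply: mbool; exact: measurable_fun_ltr.
  by apply: measurable_funM => //; exact: measurableT_comp mg mrayT.
have expV t : (0 < t)%R -> (expR (- n%:R * ln t) = t ^- n)%R.
  by move=> t0; rewrite mulNr expRN expRM_natl lnK.
pose k (tz : measurableTypeR R * 'rV[R]_n) : R :=
  ((0 < tz.1)%R%:R * (expR (- n%:R * ln tz.1) * (c1 * ((`|tz.2 - x - tz.1 *: x| <= tz.1 * (`|x| / 2))%R%:R * g tz.2))))%R.
have k0 tz : (0 <= k tz)%R.
  by rewrite !mulr_ge0// expR_ge0.
have mk : measurable_fun setT (fun tz => (k tz)%:E).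
  have mt : measurable_fun [set: measurableTypeR R * 'rV[R]_n] (fun tz => tz.1 : R).
    exact: measurable_fst.
  apply/measurable_EFinP; apply: measurable_funM.
    by apply: mbool; exact: measurable_fun_ltr.
  apply: measurable_funM.
    apply: measurableT_comp => //; apply: measurable_funM => //.
    exact: measurableT_comp (@measurable_ln R) mt.
  apply: measurable_funM => //; apply: measurable_funM; last exact: measurableT_comp mg measurable_snd.
  apply: mbool; apply: measurable_fun_ler; last exact: measurable_funM.
  apply: measurableT_comp (@measurable_norm_rV R n) _.
  apply: measurable_fun_rV => i.
  rewrite (_ : _ \o _ = (fun tz => coord_rV i tz.2 - x ord0 i - tz.1 * x ord0 i)%R); last first.
    by apply/funext => tz; rewrite /coord_rV /= !mxE.
  apply: measurable_funB; last exact: measurable_funM.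
  apply: measurable_funB => //.
  exact: measurableT_comp (measurable_coord_rV i) measurable_snd.
have step1 : (`|x| ^+ n * `|f x|)%:E <=
    \int[borel_lebesgue n]_w \int[@lebesgue_measure R]_t (h (w, t))%:E.
  have -> : (`|x| ^+ n * `|f x|)%:E = \int[borel_lebesgue n]_w (`|f x| * \1_(cube x (`|x| / 2)) w)%:E.
    rewrite integral_cube_indic ?divr_ge0//; congr EFin.
    by rewrite mulrC; congr (_ * _ ^+ n)%R; field.
  apply: ge0_le_integral; first exact: measurableT.
  - by move=> w _; rewrite lee_fin mulr_ge0.
  - apply/measurable_EFinP; apply: measurable_funM => //.
    by apply: measurable_indic; apply: measurable_cube; rewrite divr_ge0.
  - exact: (measurable_fun_fubini_tonelli_F (fun wt => (h wt)%:E) mh).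
  move=> w _; rewrite indicE; case: (boolP (w \in _)) => [|_]; last first.
    by rewrite mulr0; apply: integral_ge0 => t _; rewrite lee_fin.
  rewrite inE /cube /= => wx; rewrite mulr1.
  have wn : (`|x| / 2 <= `|w|)%R.
    have : (`|x| <= `|w| + `|w - x|)%R by rewrite -[in leLHS](subKr w x) ler_normB.
    lra.
  have wn0 : w != 0%R by rewrite -normr_gt0; apply: lt_le_trans wn; rewrite divr_gt0.
  apply: (le_trans (ray_bound x sf cf wn0)).
  have mht : measurable_fun [set: measurableTypeR R] (fun t => (h (w, t))%:E).
    exact: (measurableT_comp mh (pair1_measurable w)).
  have w32 : (`|w| <= 3 / 2 * `|x|)%R.
    have : (`|w| <= `|w - x| + `|x|)%R by rewrite -[in leLHS](subrK x w) ler_normD.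
    lra.
  apply: ge0_le_integral => //.
  - by move=> t _; rewrite lee_fin !mulr_ge0 ?enorm_ge0.
  - apply/measurable_EFinP; apply: measurable_funM; first by apply: mbool; exact: measurable_fun_ltr.
    apply: measurable_funM => //.
    exact: (measurableT_comp mg (measurableT_comp mrayT (pair1_measurable w))).
  - move=> t _; rewrite lee_fin /h /A /= wx mul1r ler_wpM2l// ler_wpM2r ?enorm_ge0//.
    by rewrite /c1 ler_wpM2l.
have step2 : \int[borel_lebesgue n]_w \int[@lebesgue_measure R]_t (h (w, t))%:E =
    \int[@lebesgue_measure R]_t \int[borel_lebesgue n]_w (h (w, t))%:E.
  exact: (fubini_tonelli (fun wt => (h wt)%:E) mh).
have step3 t : \int[borel_lebesgue n]_w (h (w, t))%:E = \int[borel_lebesgue n]_z (k (t, z))%:E.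
  have [t0|t0] := ltP 0%R t; last first.
    by rewrite !integral0_eq// => z _; rewrite /h /k /= ltNge t0/= ?mul0r ?mulr0.
  pose phi z : \bar R := (c1 * ((`|z - x - t *: x| <= t * (`|x| / 2))%R%:R * g z))%:E.
  have phi0 z : 0 <= phi z by rewrite lee_fin !mulr_ge0.
  have mphi : measurable_fun setT phi.
    apply/measurable_EFinP; apply: measurable_funM => //; apply: measurable_funM => //.
    apply: mbool; apply: measurable_fun_ler => //.
    under eq_fun do rewrite -addrA -opprD; exact: measurable_subr_rV.
  transitivity (\int[borel_lebesgue n]_w phi (x + t *: w)%R).
    apply: eq_integral => w _; rewrite /h /phi /A /= t0 mul1r; congr EFin.
    rewrite mulrCA; congr (_ * (_%:R * _))%R.
    by rewrite [(x + _)%R]addrC addrK -scalerBr normrZ gtr0_norm// ler_pM2l.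
  rewrite (ge0_integral_affine x t0 mphi phi0).
  have tn0 : (0 <= t ^- n)%R by rewrite invr_ge0 exprn_ge0// ltW.
  rewrite -ge0_integralZl_EFin//.
  by apply: eq_integral => z _; rewrite /k /phi /= t0 expV// mul1r EFinM.
have step4 : \int[@lebesgue_measure R]_t \int[borel_lebesgue n]_z (k (t, z))%:E =
    \int[borel_lebesgue n]_z \int[@lebesgue_measure R]_t (k (t, z))%:E.
  exact: (fubini_tonelli (fun tz => (k tz)%:E) mk).
have step5 z : \int[@lebesgue_measure R]_t (k (t, z))%:E <=
    (`|x| ^+ n * (C * (outer_riesz x z * g z)))%:E.
  set rho := (`|x - z|)%R.
  pose t1 := (2 * rho / (3 * `|x|))%R; pose t2 := (2 * rho / `|x|)%R.
  have [/andP[rho0 xz]|out] := boolP ((0 < `|x - z|)%R && (`|x| <= `|z|)%R); last first.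
    rewrite integral0_eq.
      by rewrite lee_fin !mulr_ge0 ?exprn_ge0 ?outer_riesz_ge0// ltW.
    move=> t _; rewrite /k /=; have [t0|] := ltP 0%R t; last by rewrite mul0r.
    case: (boolP (`|z - x - t *: x| <= _)%R) => [/(cone_geometry t0 xn0)[r0 xz _]|_]; last by rewrite mul0r !mulr0.
    by move: out; rewrite r0 xz.
  have t10 : (0 < t1)%R by rewrite divr_gt0// mulr_gt0.
  have t12 : (t1 <= t2)%R.
    rewrite /t1 /t2 invfM mulrA ler_wpM2r ?invr_ge0//.
    by have := ltW rho0; rewrite -/rho; lra.
  have cc : (0 <= t1 ^- n * (c1 * g z))%R by rewrite !mulr_ge0// invr_ge0 exprn_ge0// ltW.
  apply: (@le_trans _ _ (\int[@lebesgue_measure R]_t (t1 ^- n * (c1 * g z) * \1_(`[t1, t2]) t)%:E)).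
    apply: ge0_le_integral; first exact: measurableT.
    - by move=> t _; rewrite lee_fin.
    - exact: (measurableT_comp mk (pair2_measurable z)).
    - by apply/measurable_EFinP; apply: measurable_funM => //; exact: measurable_indic.
    move=> t _; rewrite lee_fin /k /=; have [t0|_] := ltP 0%R t; last by rewrite mul0r mulr_ge0.
    case: (boolP (`|z - x - t *: x| <= _)%R) => [/(cone_geometry t0 xn0)[_ _ /andP[tt1 tt2]]|_]; last first.
      by rewrite mul0r !mulr0 mulr_ge0.
    rewrite expV// indicE mem_set/= ?in_itv/= ?tt1// !mul1r mulr1.
    rewrite ler_wpM2r ?mulr_ge0// lef_pV2 ?posrE ?exprn_gt0//.
    by rewrite ler_pXn2r ?nnegrE// ltW.
  rewrite integral_itv_indic// lee_fin le_eqVlt; apply/orP; left; apply/eqP.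
  rewrite /outer_riesz rho0 xz/=.
  have -> : (expR ((1 - n%:R) * ln `|x - z|) = rho * rho ^- n)%R.
    by rewrite mulrBl mul1r expRD lnK// -expV// mulNr.
  rewrite -/rho /t1 /t2 /c1 /C !exprMn !exprVn !exprMn.
  field.
  by rewrite !expf_neq0 ?gt_eqF.
have xn : (0 < `|x| ^+ n)%R by rewrite exprn_gt0.
have mz : measurable_fun setT (fun z => (C * (outer_riesz x z * g z))%:E).
  apply/measurable_EFinP; apply: measurable_funM => //; apply: measurable_funM => //.
  exact: measurable_outer_riesz.
have z0 z : 0 <= (C * (outer_riesz x z * g z))%:E.
  by rewrite lee_fin !mulr_ge0 ?outer_riesz_ge0// ltW.
rewrite -(@lee_pmul2l _ (`|x| ^+ n)%:E) ?lte_fin// -EFinM.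
apply: (le_trans step1); rewrite step2 (eq_integral _ _ (fun t _ => step3 t)) step4.
rewrite -ge0_integralZl_EFin ?exprn_ge0//.
apply: ge0_le_integral; first exact: measurableT.
- by move=> z _; apply: integral_ge0 => t _; rewrite lee_fin.
- exact: (measurable_fun_fubini_tonelli_G (fun tz => (k tz)%:E) mk).
- exact: measurable_funeM.
- by move=> z _; rewrite -EFinM; exact: step5.
Qed.

End representation.

(** * Consequences of log-Hoelder continuity *)

Section oscillation.
Context {R : realType} (n : nat) (n0 : (0 < n)%N).

(** The Euclidean distance in the hypothesis is at most n times the sup norm
    distance r, so that minus its logarithm is at least half of -ln r when
    r <= (2n)^-2; for larger r the boundedness of P suffices. *)
Lemma osc_small (P : 'rV[R]_n -> R) (C q : R) :
  0 <= C -> 0 <= q -> (forall x y, `|P x - P y| <= q) ->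
  (forall x y, enorm (x - y) < 2^-1 -> `|P x - P y| * - ln (enorm (x - y)) <= C) ->
  exists L : R, 0 <= L /\ forall x y, 0 < `|x - y| -> `|x - y| <= 1 ->
    `|P x - P y| * `|ln `|x - y| | <= L.
Proof.
move=> C0 q0 Pq LH; have n1 : 1 <= n%:R :> R by rewrite ler1n.
have l2n : 0 <= ln (2 * n%:R) :> R by apply: ln_ge0; lra.
exists (2 * C + q * (2 * ln (2 * n%:R))); split.
  by rewrite addr_ge0// mulr_ge0// mulr_ge0.
move=> x y r0 r1; set r := `|x - y| in r0 r1 *.
have lr0 : ln r <= 0 by exact: ln_le0.
rewrite (ler0_norm lr0).
have D0 := normr_ge0 (P x - P y).
have h0 : 0 <= q * (2 * ln (2 * n%:R)) by rewrite mulr_ge0// mulr_ge0.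
have [rn|rn] := leP (ln r) (- (2 * ln (2 * n%:R))); last first.
  have : `|P x - P y| * - ln r <= q * (2 * ln (2 * n%:R)).
    by apply: ler_pM => //; [rewrite oppr_ge0|rewrite lerNl ltW].
  lra.
have e0 : 0 < enorm (x - y) by apply: lt_le_trans (norm_le_enorm _).
have nr : enorm (x - y) <= n%:R * r by exact: enorm_le_norm.
have nR : 0 < n%:R :> R by lra.
have lnn : ln (2 * n%:R) = ln 2 + ln n%:R :> R by rewrite lnM ?posrE.
have l2 : 0 < ln 2 :> R by rewrite ln_gt0// ltr1n.
have lnn0 : 0 <= ln n%:R :> R by exact: ln_ge0.
have le : ln (enorm (x - y)) <= ln n%:R + ln r.
  by rewrite -lnM ?posrE// ler_ln ?posrE// mulr_gt0.
have : enorm (x - y) < 2^-1.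
  rewrite -ltr_ln ?posrE ?invr_gt0// lnV ?posrE//.
  by apply: le_lt_trans le _; lra.
move=> /LH h.
have : `|P x - P y| * - ln r <= `|P x - P y| * (2 * - ln (enorm (x - y))).
  by rewrite ler_wpM2l//; lra.
lra.
Qed.

(** Both values are compared with the value pinf at infinity. *)
Lemma osc_large (P : 'rV[R]_n -> R) (C pinf : R) : 0 <= C ->
  (forall x, `|P x - pinf| * ln (expR 1 + enorm x) <= C) ->
  forall x y, 1 <= `|x| -> `|x| <= 2 * `|y| ->
    `|P x - P y| * ln `|x| <= 3 * C.
Proof.
move=> C0 LH x y x1 xy; have e2 : 2 <= expR 1 :> R by exact: (@expR_ge1Dx R 1).
have xe := norm_le_enorm x; have ye := norm_le_enorm y.
have lx : ln `|x| <= ln (expR 1 + enorm x) by rewrite ler_ln ?posrE; lra.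
have ly : ln `|x| <= 2 * ln (expR 1 + enorm y).
  rewrite mulr_natl -lnXn; last lra.
  rewrite ler_ln ?posrE ?exprn_gt0; [|lra..].
  apply: (le_trans xy); rewrite expr2.
  have : 2 * `|y| <= (expR 1 + enorm y) * (expR 1 + enorm y).
    by apply: ler_pM; lra.
  by [].
have h1 : `|P x - pinf| * ln `|x| <= C by apply: le_trans (LH x); rewrite ler_wpM2l.
have h2 : `|P y - pinf| * ln `|x| <= 2 * C.
  apply: (@le_trans _ _ (`|P y - pinf| * (2 * ln (expR 1 + enorm y)))).
    by rewrite ler_wpM2l.
  have := LH y; lra.
have h3 : `|P x - P y| <= `|P x - pinf| + `|P y - pinf|.
  by rewrite (distrC (P y)); exact: ler_distD.
have := ler_wpM2r (ln_ge0 x1) h3; lra.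
Qed.

End oscillation.

(** The rate K is the bound q itself: passing from |z| to a smaller |x| costs at
    most q ln (|z|/|x|), so the logarithm of |x| only has to be controlled when |x|
    and |z| are both small or both large. For the weight |x|^(a + n/q x) against
    |z|^(a + n/q z), powers are compared at |z| if both points lie in the unit
    cube, at |x| if both lie outside, and through 1 otherwise. *)
Lemma log_hoelder_admissible {R : realType} (n : nat) (P Q : 'rV[R]_n -> R)
    (C pinf al a ep p0 q : R) :
  (0 < n)%N -> 0 <= C ->
  (forall x y, enorm (x - y) < 2^-1 -> `|P x - P y| * - ln (enorm (x - y)) <= C) ->
  (forall x, `|P x - pinf| * ln (expR 1 + enorm x) <= C) ->
  measurable_fun setT P -> measurable_fun setT Q ->
  1 < p0 -> (forall x, p0 <= P x) -> (forall x, P x <= Q x) -> (forall x, Q x <= q) ->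
  0 <= al <= 1 -> (forall x, n%:R / P x - al = n%:R / Q x) ->
  0 < ep -> ep <= a + n%:R / q ->
  exists L, admissible P Q al a ep L q (n%:R / q) (n%:R / p0) q.
Proof.
move=> n0 C0 LH LHoo mP mQ p01 p0P PQ Qq al01 def ep0 epa.
have nR : 0 < n%:R :> R by rewrite ltr0n.
have P1 x : 1 <= P x by rewrite (le_trans (ltW p01)).
have P0 x : 0 < P x by exact: lt_le_trans (P1 x).
have Q0 x : 0 < Q x by exact: lt_le_trans (PQ x).
have q0 : 0 < q by exact: lt_le_trans (Qq 0).
have Pq x : P x <= q by exact: le_trans (PQ x) (Qq x).
have D_le_q x y : `|P x - P y| <= q.
  have := P0 x; have := P0 y; have := Pq x; have := Pq y.
  by rewrite ler_norml; lra.
have [L1 [L10 small]] := osc_small n0 C0 (ltW q0) D_le_q LH.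
have large := osc_large C0 LHoo.
have l2 : 0 < ln 2 :> R by rewrite ln_gt0// ltr1n.
have xyle (x y : 'rV[R]_n) : `|x| <= `|x - y| + `|y|.
  by rewrite -[in leLHS](subrK y x) ler_normD.
(* Two points near the origin are close to each other: |x-z| <= 2|z|. *)
have inner x z : 0 < `|x| -> `|x| <= `|z| -> `|z| <= 1 ->
    `|P x - P z| * - ln `|z| <= L1 + q * ln 2.
  move=> x0 xz z1; have z0 : 0 < `|z| by exact: lt_le_trans xz.
  have D0 := normr_ge0 (P x - P z).
  have qn : 0 <= q * ln 2 by rewrite mulr_ge0// ltW.
  have [zh|zh] := leP (ln `|z|) (- ln 2); last first.
    have : `|P x - P z| * - ln `|z| <= q * ln 2.
      by rewrite ler_pM// ?oppr_ge0 ?ln_le0// lerNl ltW.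
    lra.
  have [->|xnz] := eqVneq x z; first by rewrite subrr normr0 mul0r addr_ge0.
  have r0 : 0 < `|x - z| by rewrite normr_gt0 subr_eq0.
  have rz : `|x - z| <= 2 * `|z|.
    by apply: le_trans (ler_normB _ _) _; lra.
  have lr : ln `|x - z| <= ln 2 + ln `|z|.
    by rewrite -lnM ?posrE// ler_ln ?posrE// mulr_gt0.
  have r1 : `|x - z| <= 1 by rewrite -ler_ln ?posrE// ln1; lra.
  have := small _ _ r0 r1; rewrite (ler0_norm (ln_le0 r1)) => h.
  have h1 : `|P x - P z| * - ln `|z| <= `|P x - P z| * (- ln `|x - z| + ln 2).
    by rewrite ler_wpM2l//; lra.
  have h2 : `|P x - P z| * ln 2 <= q * ln 2 by rewrite ler_wpM2r// ltW.
  lra.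
have DU x z : `|n%:R / P x - n%:R / P z| <= n%:R * `|P x - P z|.
  rewrite (_ : n%:R / P x - n%:R / P z = n%:R * (P z - P x) / (P x * P z)); last first.
    by field; rewrite !gt_eqF.
  rewrite 2!normrM (gtr0_norm nR) (distrC (P z)) ger0_norm; last first.
    by rewrite invr_ge0 mulr_ge0// ltW.
  rewrite ler_pdivrMr ?mulr_gt0// ler_peMr ?mulr_ge0 ?(ltW nR)//.
  by have := ler_pM ler01 ler01 (P1 x) (P1 z); rewrite mulr1.
pose L0 := L1 + q * ln 2 + 3 * C.
have qn : 0 <= q * ln 2 by rewrite mulr_ge0// ltW.
have L00 : 0 <= L0 by rewrite /L0; lra.
have nL : L0 <= n%:R * L0 by rewrite ler_peMl// ler1n.
exists (n%:R * L0); split => //.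
- exact: divr_gt0.
- by rewrite ltr_pdivrMr ?(lt_trans ltr01)// ltr_pMr.
- exact: le_trans nL.
- exact: ltW.
- by move=> x; rewrite ler_pM2l// lef_pV2 ?posrE.
- by move=> x; rewrite ler_pM2l// lef_pV2 ?posrE// (lt_trans ltr01).
- move=> x z r0 rx.
  have x0 : 0 < `|x| by lra.
  have xz : `|x| <= 2 * `|z| by have := xyle x z; lra.
  suff h (t : R) : `|P x - P z| * `|t| <= L0 -> `|n%:R / P x - n%:R / P z| * `|t| <= n%:R * L0.
    have lx : `|P x - P z| * `|ln `|x| | <= L0.
      have [x1|x1] := leP 1 `|x|.
        by rewrite (ger0_norm (ln_ge0 x1)); apply: le_trans (large x z x1 xz) _; rewrite /L0; lra.
      have r1 : `|x - z| <= 1 by lra.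
      apply: (@le_trans _ _ L1); last by rewrite /L0; lra.
      apply: le_trans (small _ _ r0 r1); rewrite ler_wpM2l//.
      rewrite !ler0_norm ?ln_le0 ?(ltW x1)// lerN2 ler_ln ?posrE//; lra.
    split; apply: h => //.
    have [r1|r1] := leP `|x - z| 1.
      by apply: le_trans (small _ _ r0 r1) _; rewrite /L0; lra.
    apply: le_trans lx; rewrite ler_wpM2l// !ger0_norm ?ln_ge0; [|lra..].
    by rewrite ler_ln ?posrE; lra.
  move=> h; apply: (@le_trans _ _ (n%:R * (`|P x - P z| * `|t|))).
    by rewrite mulrA ler_wpM2r.
  by rewrite ler_pM2l.
- move=> x z x0 xz; have z0 : 0 < `|z| by exact: lt_le_trans xz.
  set X := ln `|x|; set Z := ln `|z|.
  have XZ : X <= Z by rewrite ler_ln ?posrE.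
  have D0 := normr_ge0 (P x - P z).
  have DXZ : `|P x - P z| * (Z - X) <= q * (Z - X) by rewrite ler_wpM2r// subr_ge0.
  have Vep y : ep <= a + n%:R / Q y.
    by rewrite (le_trans epa)// lerD2l ler_pM2l// lef_pV2 ?posrE.
  have DV : `|n%:R / Q x - n%:R / Q z| <= n%:R * `|P x - P z|.
    by rewrite -!def opprB addrA subrK; exact: DU.
  have VDt (t B : R) : 0 <= t -> `|P x - P z| * t <= B -> B <= L0 ->
      (n%:R / Q x - n%:R / Q z) * t <= n%:R * L0 /\ (n%:R / Q z - n%:R / Q x) * t <= n%:R * L0.
    move=> t0 tB BL; have : `|n%:R / Q x - n%:R / Q z| * t <= n%:R * L0.
      apply: (@le_trans _ _ (n%:R * (`|P x - P z| * t))); first by rewrite mulrA ler_wpM2r.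
      by rewrite ler_pM2l// (le_trans tB).
    move=> h; split; apply: le_trans h; rewrite ler_wpM2r// ?ler_norm//.
    by rewrite distrC ler_norm.
  have [x1|x1] := leP 1 `|x|.
    have X0 : 0 <= X by exact: ln_ge0.
    have xz2 : `|x| <= 2 * `|z| by lra.
    have lg := large x z x1 xz2.
    have qXZ : 0 <= q * (Z - X) by rewrite mulr_ge0 ?subr_ge0// ltW.
    have B3 : 3 * C <= L0 by rewrite /L0; lra.
    rewrite (ger0_norm X0); split; first by move: nL lg B3 qXZ; rewrite -/X; clear; lra.
    have [h _] := VDt _ _ X0 lg B3.
    have := ler_wpM2r (_ : 0 <= Z - X) (Vep z); rewrite subr_ge0 => /(_ XZ).
    by move: h; clear; lra.
  have X0 : X <= 0 by rewrite ln_le0// ltW.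
  rewrite (ler0_norm X0).
  have [z1|z1] := leP `|z| 1.
    have Z0 : Z <= 0 by exact: ln_le0.
    have inn := inner _ _ x0 xz z1.
    have B3 : L1 + q * ln 2 <= L0 by rewrite /L0; lra.
    split; first by move: inn B3 DXZ nL; rewrite -/Z; clear; lra.
    have NZ : 0 <= - Z by rewrite oppr_ge0.
    have [_ h] := VDt _ _ NZ inn B3.
    have := ler_wpM2r (_ : 0 <= Z - X) (Vep x); rewrite subr_ge0 => /(_ XZ).
    by move: h; clear; lra.
  have Z0 : 0 <= Z by rewrite ln_ge0// ltW.
  split.
    have : `|P x - P z| * - X <= `|P x - P z| * (Z - X) by rewrite ler_wpM2l//; lra.
    by move: DXZ nL L00; clear; lra.
  have h1 := ler_wpM2r Z0 (Vep z).
  have h2 := ler_wnM2r X0 (Vep x).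
  by move: h1 h2 nL L00; clear; lra.
Qed.

Lemma log_hoelder_continuous {R : realType} (n : nat) (P : 'rV[R]_n -> R) (C : R) :
  0 <= C ->
  (forall x y, enorm (x - y) < 2^-1 -> `|P x - P y| * - ln (enorm (x - y)) <= C) ->
  continuous P.
Proof.
move=> C0 LH x; apply/(@cvgrPdist_le _ _ _ (nbhs x)) => e e0.
pose m : R := Order.min (2^-1) (expR (- (C / e + 1))).
have m0 : 0 < m by rewrite lt_min invr_gt0 ltr0n expR_gt0.
have n1 : 0 < n.+1%:R :> R by [].
apply/nbhs_ballP; exists (m / n.+1%:R) => /=; first exact: divr_gt0.
move=> y; rewrite -ball_normE /ball_/= => xym.
have [->|xy] := eqVneq x y; first by rewrite subrr normr0 ltW.
have e1 : enorm (x - y) < m.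
  apply: le_lt_trans (enorm_le_norm _) _.
  move: xym; rewrite ltr_pdivlMr// => h; apply: le_lt_trans h.
  by rewrite mulrC ler_wpM2l// ler_nat.
have e2 : enorm (x - y) < 2^-1 by apply: lt_le_trans e1 _; rewrite ge_min lexx.
have ep : 0 < enorm (x - y).
  by apply: lt_le_trans (norm_le_enorm _); rewrite normr_gt0 subr_eq0.
have le : C / e + 1 <= - ln (enorm (x - y)).
  rewrite lerNr -ler_expR lnK//; apply: ltW; apply: lt_le_trans e1 _.
  by rewrite ge_min lexx orbT.
have Ce : 0 <= C / e by rewrite divr_ge0// ltW.
have k0 : 0 < C / e + 1 by rewrite ltr_wpDl.
rewrite -(ler_pM2r k0); apply: (@le_trans _ _ C).
  by apply: le_trans (LH x y e2); rewrite ler_wpM2l.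
by rewrite mulrDr mulr1 mulrC divfK ?gt_eqF// lerDl ltW.
Qed.

(** A set of full measure meets every cube. *)
Lemma continuous_ae_ge {R : realType} (n : nat) (P : 'rV[R]_n -> R) (c : R) :
  continuous P -> (\forall x \ae lebesgue_rV R n, c <= P x) -> forall x, c <= P x.
Proof.
move=> cP [A [mA A0 cA]] x; rewrite leNgt; apply/negP => Pxc.
have /nbhs_ballP[r /= r0 xr] : nbhs x (P @^-1` [set t | t < c]).
  by apply: cP; exact: lt_nbhsl.
have cubeA : cube x (r / 2) `<=` A.
  move=> y yx; apply: cA => /=; apply/negP; rewrite -ltNge; apply: xr.
  rewrite -ball_normE /ball_/= distrC; apply: le_lt_trans yx _; lra.
have r20 : 0 <= r / 2 by rewrite divr_ge0// ltW.
have mc : measurable (cube x (r / 2)) by exact: measurable_cube.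
have : (lebesgue_rV R n (cube x (r / 2)) <= lebesgue_rV R n A)%E.
  apply: le_measure; rewrite ?inE//.
  by apply: (@sub_caratheodory _ _ _ (borel_lebesgue n)); exact: sub_sigma_algebra.
rewrite A0 lebesgue_rV_borel// borel_lebesgue_cube// lee_fin leNgt exprn_gt0//.
by rewrite mulr_gt0// divr_gt0.
Qed.

(** Multiplying out the denominators makes the two conditions meaningful for any
    sign of the constants and at x = y; the condition at infinity excludes the
    value +oo. *)
Lemma log_hoelder_real {R : realType} n (p : 'rV[R]_n -> \bar R) : log_hoelder p ->
  (forall x, p x = (fine (p x))%:E) /\ exists C pinf : R, [/\ 0 <= C,
    (forall x y, enorm (x - y) < 2^-1 ->
      `|fine (p x) - fine (p y)| * - ln (enorm (x - y)) <= C) &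
    (forall x, `|fine (p x) - pinf| * ln (expR 1 + enorm x) <= C)].
Proof.
move=> [[C0 LH] [C1 [pinf LHoo]]].
have pE x : p x = (fine (p x))%:E.
  by have := LHoo x; case: (p x).
split => //; exists (Order.max 0 (Order.max C0 C1)), pinf.
split; first by rewrite le_max lexx.
- move=> x y xy; have := LH x y xy; rewrite (pE x) (pE y) /= lee_fin.
  have C0m : C0 <= Order.max 0 (Order.max C0 C1) by rewrite !le_max lexx orbT.
  have [e0|] := leP (- ln (enorm (x - y))) 0.
    by move=> _; apply: (@le_trans _ _ 0); [rewrite mulr_ge0_le0|rewrite le_max lexx].
  by move=> e0; rewrite ler_pdivlMr// => /le_trans; apply.
- move=> x; have := LHoo x; rewrite (pE x) /= lee_fin.
  have e0 : 0 < ln (expR 1 + enorm x).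
    rewrite ln_gt0// ltr_wpDr ?enorm_ge0//.
    by rewrite -expR0 ltr_expR.
  by rewrite ler_pdivlMr// => /le_trans; apply; rewrite !le_max lexx !orbT.
Qed.

(** * The weighted inequality *)

Lemma powR_comparable {R : realType} (n : nat) (c : R) (z : 'rV[R]_n) : z != 0 ->
  enorm z `^ c <= expR (`|c| * ln n%:R) * expR (c * ln `|z|) /\
  expR (c * ln `|z|) <= expR (`|c| * ln n%:R) * enorm z `^ c.
Proof.
move=> z0; have zn : 0 < `|z| by rewrite normr_gt0.
have ze := norm_le_enorm z; have ez := enorm_le_norm z.
have e0 : 0 < enorm z by exact: lt_le_trans ze.
have nR : 0 < n%:R :> R by rewrite -(pmulr_lgt0 _ zn); exact: lt_le_trans ez.
rewrite /powR gt_eqF// -!expRD !ler_expR.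
have l1 : ln `|z| <= ln (enorm z) by rewrite ler_ln ?posrE.
have l2 : ln (enorm z) <= ln n%:R + ln `|z|.
  by rewrite -lnM ?posrE// ler_ln ?posrE// mulr_gt0.
have : `|c * (ln (enorm z) - ln `|z|)| <= `|c| * ln n%:R.
  by rewrite normrM ler_wpM2l// ger0_norm; lra.
by rewrite ler_norml => /andP[]; lra.
Qed.

(** Where |x-z| > |x|/2 and |x| <= |z|, one has |z| <= 3|x-z|. *)
Lemma outer_riesz_le_critical {R : realType} (n : nat) (a b : R) (x z : 'rV[R]_n) :
  (0 < n)%N -> x != 0 ->
  expR (a * ln `|x| - b * ln `|z|) * outer_riesz x z <=
  expR (`|b| + 2 * n%:R) * critical_kernel (1 + a - b) a x z.
Proof.
move=> n0 xn0; rewrite /outer_riesz; case: ifPn => [/andP[r0 xz]|_]; last first.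
  by rewrite mulr0 mulr_ge0 ?expR_ge0 ?critical_kernel_ge0.
have x0 : 0 < `|x| by rewrite normr_gt0.
have z0 : 0 < `|z| by exact: lt_le_trans xz.
have n1 : 1 <= n%:R :> R by rewrite ler1n.
have zx : `|z| <= `|x| + `|x - z|.
  by rewrite -[in leLHS](subKr x z); apply: le_trans (ler_normB _ _) _.
have lxz : ln `|x| <= ln `|z| by rewrite ler_ln ?posrE.
rewrite /critical_kernel r0 x0 xz /=; case: ifPn => [rx|]; last first.
  rewrite -ltNge => rx; rewrite -!expRD ler_expR.
  have lz : ln `|z| <= 2 + ln `|x - z|.
    rewrite -ler_expR expRD !lnK//; apply: (@le_trans _ _ (3 * `|x - z|)); first lra.
    by rewrite ler_wpM2r//; have := @expR_ge1Dx R 2; lra.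
  have := ler_wpM2l (_ : 0 <= n%:R - 1) lz; rewrite subr_ge0 => /(_ n1).
  have := normr_ge0 b; lra.
rewrite -!expRD ler_expR.
have lz : ln `|z| <= 1 + ln `|x|.
  rewrite -ler_expR expRD !lnK//; apply: (@le_trans _ _ (2 * `|x|)); first lra.
  by rewrite ler_wpM2r//; have := @expR_ge1Dx R 1; lra.
have : `|b * (ln `|z| - ln `|x|)| <= `|b|.
  by rewrite normrM ler_piMr// ger0_norm; lra.
rewrite ler_norml => /andP[]; lra.
Qed.

Lemma enormZ {R : realType} n (c : R) (x : 'rV[R]_n) : enorm (c *: x) = `|c| * enorm x.
Proof.
rewrite /enorm -sqrtr_sqr -sqrtrM ?sqr_ge0//; congr Num.sqrt.
by rewrite mulr_sumr; apply: eq_bigr => i _; rewrite mxE exprMn.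
Qed.

(** [modular_bound] applied to F = |x|^a |f| / (C0 l) and G = |z|^b |grad f| / l. The
    constant C0 absorbs the representation constant and the changes between
    Euclidean and sup norms; a last factor C7 >= 1 brings the modular below 1, since
    (t / C7)^q <= t^q / C7 when q >= 1. *)
Lemma weighted_modular_bound {R : realType} n (P Q : 'rV[R]_n -> R)
    (a b ep L K V0 U1 q : R) :
  admissible P Q (1 + a - b) a ep L K V0 U1 q ->
  exists C : R, 0 < C /\ forall f, smooth f -> compactly_supported f ->
  forall l : R, 0 < l ->
  (\int[lebesgue_rV R n]_x
    ((`|enorm (enorm x `^ b *: gradient f x)| / l) `^ P x)%:E <= 1)%E ->
  (\int[lebesgue_rV R n]_x ((`|enorm x `^ a * f x| / (C * l)) `^ Q x)%:E <= 1)%E.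
Proof.
move=> H; have [C4 [C40 Hmod]] := modular_bound H.
have n0 := dim_gt0 H; have mP := measurable_P H; have mQ := measurable_Q H.
have Q1 x : 1 <= Q x by exact: le_trans (P_ge1 H x) (P_le_Q H x).
have [C1 [C10 Hrep]] := @outer_riesz_bound R n n0.
pose K2 : R := expR (`|b| * ln n%:R); pose K3 : R := expR (`|b| + 2 * n%:R).
pose K6 : R := expR (`|a| * ln n%:R); pose C7 : R := Order.max 1 C4.
pose C0 := C1 * K2 * K3.
have K20 : 0 < K2 by exact: expR_gt0.
have K30 : 0 < K3 by exact: expR_gt0.
have K60 : 0 < K6 by exact: expR_gt0.
have C00 : 0 < C0 by rewrite !mulr_gt0.
have C71 : 1 <= C7 by rewrite le_max lexx.
have C70 : 0 < C7 by exact: lt_le_trans C71.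
exists (K6 * C0 * C7); split; first by rewrite !mulr_gt0.
move=> f sf cf l l0 HG.
have mg := measurable_enorm_gradient sf; have me := @measurable_enorm R n.
have mf : measurable_fun setT f.
  by apply: continuous_measurable_rV; exact: smooth_continuous.
have mln : measurable_fun setT (fun x : 'rV[R]_n => ln `|x|).
  exact: measurableT_comp (@measurable_ln R) (@measurable_norm_rV R n).
have mpow c : measurable_fun setT (fun x : 'rV[R]_n => enorm x `^ c).
  by apply: measurable_powR_fun.
pose G (z : 'rV[R]_n) : R := `|enorm (enorm z `^ b *: gradient f z)| / l.
have GE z : G z = enorm z `^ b * enorm (gradient f z) / l.
  by rewrite /G ger0_norm ?enorm_ge0// enormZ ger0_norm ?powR_ge0.
have G0 z : 0 <= G z by rewrite /G divr_ge0// ltW.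
have mG : measurable_fun setT G.
  have -> : G = (fun z => enorm z `^ b * enorm (gradient f z) / l) by apply/funext.
  by apply: measurable_funM => //; exact: measurable_funM.
pose F (x : 'rV[R]_n) : R := (0 < `|x|)%R%:R * (expR (a * ln `|x|) * `|f x| / (C0 * l)).
have C0l : 0 < C0 * l by exact: mulr_gt0.
have F0 x : 0 <= F x by rewrite !mulr_ge0 ?expR_ge0// invr_ge0 ltW.
have mF : measurable_fun setT F.
  apply: measurable_funM.
    apply: (measurableT_comp (f := fun b : bool => b%:R : R)) => //.
    by apply: measurable_fun_ltr => //; exact: measurable_norm_rV.
  apply: measurable_funM => //; apply: measurable_funM; last exact: measurableT_comp.
  by apply: measurableT_comp => //; exact: measurable_funM.
have F00 : F 0 = 0 by rewrite /F normr0 ltxx mul0r.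
have HF x : x != 0 -> ((F x)%:E <=
    \int[borel_lebesgue n]_z (critical_kernel (1 + a - b) a x z * G z)%:E)%E.
  move=> xn0; pose k := expR (a * ln `|x|) / (C0 * l).
  have k0 : 0 <= k by rewrite divr_ge0 ?expR_ge0// ltW.
  have -> : F x = k * `|f x| by rewrite /F normr_gt0 xn0 mul1r /k mulrAC.
  have mr : measurable_fun setT (fun z => C1 * (outer_riesz x z * enorm (gradient f z))).
    apply: measurable_funM => //; apply: measurable_funM => //.
    exact: measurable_outer_riesz.
  have r0 z : 0 <= C1 * (outer_riesz x z * enorm (gradient f z)).
    by rewrite !mulr_ge0 ?outer_riesz_ge0 ?enorm_ge0// ltW.
  rewrite EFinM; apply: (le_trans (lee_wpmul2l _ (Hrep f sf cf x xn0))).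
    by rewrite lee_fin.
  rewrite -ge0_integralZl_EFin//; last 2 first.
  - by move=> z _; rewrite lee_fin.
  - exact/measurable_EFinP.
  apply: ge0_le_integral; first exact: measurableT.
  - by move=> z _; rewrite -EFinM lee_fin mulr_ge0.
  - by apply: measurable_funeM; exact/measurable_EFinP.
  - apply/measurable_EFinP; apply: measurable_funM => //.
    exact: measurable_critical_kernel.
  move=> z _; rewrite -EFinM lee_fin.
  have [z0|z0] := eqVneq z 0.
    have x0 : 0 < `|x| by rewrite normr_gt0.
    rewrite /outer_riesz z0 normr0 (leNgt `|x|) x0 andbF mul0r !mulr0.
    by rewrite mulr_ge0// critical_kernel_ge0.
  have [_ hz] := powR_comparable b z0.
  have hk := outer_riesz_le_critical a b z n0 xn0.
  set g := enorm (gradient f z) in GE *; rewrite GE -/K2 -/g in hz *.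
  have g0 : 0 <= g by exact: enorm_ge0.
  have or0 := outer_riesz_ge0 x z.
  have pw0 : 0 <= enorm z `^ b by exact: powR_ge0.
  rewrite /k; set E := expR (a * ln `|x|).
  have h1 : expR (a * ln `|x| - b * ln `|z|) = E / expR (b * ln `|z|).
    by rewrite expRD expRN.
  rewrite h1 -/K3 in hk.
  set B := expR (b * ln `|z|) in hz hk; have B0 : 0 < B by exact: expR_gt0.
  set kk := critical_kernel _ _ _ _ in hk *.
  have E0 : 0 < E by exact: expR_gt0.
  rewrite (_ : E / (C0 * l) * (C1 * (outer_riesz x z * g)) =
      (E / B * outer_riesz x z) * (B * g) / (K2 * K3 * l)); last first.
    by rewrite /C0; field; rewrite !gt_eqF.
  rewrite ler_pdivrMr ?mulr_gt0//.
  rewrite (_ : kk * _ * _ = (K3 * kk) * ((K2 * enorm z `^ b) * g)); last first.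
    by field; rewrite gt_eqF.
  apply: ler_pM => //; last exact: ler_wpM2r.
    by rewrite mulr_ge0// divr_ge0// ltW.
  by rewrite mulr_ge0// ltW.
have mint : measurable_fun setT (fun x => ((`|enorm x `^ a * f x| / (K6 * C0 * C7 * l)) `^ Q x)%:E).
  apply/measurable_EFinP; apply: measurable_powR_fun => //.
  apply: measurable_funM => //; apply: measurableT_comp => //.
  exact: measurable_funM.
have := Hmod F G mF mG F0 G0 F00 HF.
rewrite -ge0_integral_lebesgue_rV; last 2 first.
- by apply/measurable_EFinP; exact: measurable_powR_fun.
- by move=> z; rewrite lee_fin powR_ge0.
move=> /(_ HG) HFQ.
rewrite ge0_integral_lebesgue_rV//; last by move=> x; rewrite lee_fin powR_ge0.
apply: (@le_trans _ _ (\int[borel_lebesgue n]_x ((C7^-1)%:E * (F x `^ Q x)%:E)))%E.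
  apply: ae_ge0_le_integral => //.
  - by move=> x _; rewrite lee_fin powR_ge0.
  - by move=> x _; rewrite -EFinM lee_fin mulr_ge0 ?powR_ge0// invr_ge0 ltW.
  - by apply: measurable_funeM; apply/measurable_EFinP; exact: measurable_powR_fun.
  exists (cube 0 0); split.
  - exact: measurable_cube.
  - by apply: etrans (borel_lebesgue_cube _ _) _; rewrite // mulr0 expr0n eqn0Ngt n0.
  move=> x /= hx; rewrite /cube /= subr0 normr_le0; apply: contrapT => /negP xn0; apply: hx => _.
  rewrite -EFinM lee_fin.
  have [hz _] := powR_comparable a xn0.
  have Fx : `|enorm x `^ a * f x| / (K6 * C0 * C7 * l) <= C7^-1 * F x.
    rewrite /F normr_gt0 xn0 mul1r normrM (ger0_norm (powR_ge0 _ _)).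
    rewrite (_ : C7^-1 * _ = K6 * expR (a * ln `|x|) * `|f x| / (K6 * C0 * C7 * l)); last first.
      by field; rewrite !gt_eqF.
    by rewrite ler_wpM2r ?ler_wpM2r// invr_ge0 !mulr_ge0// ltW.
  apply: (@le_trans _ _ ((C7^-1 * F x) `^ Q x)).
    apply: ge0_ler_powR => //; rewrite ?nnegrE.
    - by rewrite (le_trans ler01).
    - by rewrite divr_ge0// !mulr_ge0// ltW.
    - by rewrite mulr_ge0// invr_ge0 ltW.
  rewrite powRM ?invr_ge0 ?(ltW C70)// ler_wpM2r ?powR_ge0//.
  by apply: ge1r_powR => //; rewrite invr_gt0 C70 invf_le1.
rewrite ge0_integralZl_EFin//; last 3 first.
- by move=> x _; rewrite lee_fin powR_ge0.
- by apply/measurable_EFinP; exact: measurable_powR_fun.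
- by rewrite invr_ge0 ltW.
apply: (@le_trans _ _ ((C7^-1)%:E * C4%:E))%E.
  by rewrite lee_wpmul2l// lee_fin invr_ge0 ltW.
rewrite -EFinM lee_fin mulrC ler_pdivrMr// mul1r.
by rewrite le_max lexx orbT.
Qed.

Unset Implicit Arguments.
Local Open Scope ereal_scope.

(* [`^] gives 0 at the origin when the power is negative; the origin is a null
   set, so the norms below do not see this value. *)
Theorem theorem1p3 (R : realType) (n : nat) (p q : 'rV[R]_n -> \bar R) (a b : R)
  (hn : (0 < n)%N)
  (hp : exponent p) (hq : exponent q)
  (hpLH : log_hoelder p) (hqLH : log_hoelder q)
  (hp_bounds : [/\ 1 < exponent_inf p, exponent_inf p <= exponent_sup p
                 & exponent_sup p < +oo])
  (hq_bounds : [/\ 1 < exponent_inf q, exponent_inf q <= exponent_sup q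
                 & exponent_sup q < +oo])
  (hpq : forall x, p x <= q x)
  (ha : - (n%:R%:E / exponent_sup q) < a%:E)
  (hab : (a <= b)%R)
  (hb : b%:E < n%:R%:E / hoelder_conjugate (exponent_inf p))
  (hdefect : forall x,
     (p x)^-1 - (q x)^-1 = (n%:R^-1 + (a - b) / n%:R)%:E) :
  exists C : R, (0 < C)%R /\
    forall f : 'rV[R]_n -> R, smooth f -> compactly_supported f ->
      luxemburg_norm q (fun x => (enorm x `^ a * f x)%R) <=
      C%:E * luxemburg_norm p (fun x => enorm (enorm x `^ b *: gradient f x)%R).
Proof.
have [pE [C [pinf [C0 LH LHoo]]]] := log_hoelder_real hpLH.
have [qE [Cq [qinf [Cq0 LHq _]]]] := log_hoelder_real hqLH.
pose P x := fine (p x); pose Q x := fine (q x).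
have cP : continuous P by exact: log_hoelder_continuous C0 LH.
have cQ : continuous Q by exact: log_hoelder_continuous Cq0 LHq.
have nR : (0 < n%:R :> R)%R by rewrite ltr0n.
have [p0 p0E p01] : exists2 p0 : R, exponent_inf p = p0%:E & (1 < p0)%R.
  case: hp_bounds; case: (exponent_inf p) => [r|//|//].
    by rewrite lte_fin => r1 _ _; exists r.
  by move=> _ h1 h2; have := le_lt_trans h1 h2.
have [q1 q1E] : exists q1 : R, exponent_sup q = q1%:E.
  case: hq_bounds => h1 h2 h3; have := lt_le_trans h1 h2.
  by move: h3; case: (exponent_sup q) => [r|//|//] _ _; exists r.
have p0P x : (p0 <= P x)%R.
  apply: continuous_ae_ge cP _ x; have := @ess_inf_le _ _ R (lebesgue_rV R n) p.
  by apply: filterS => x; rewrite -/(exponent_inf p) p0E pE lee_fin.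
have Qq x : (Q x <= q1)%R.
  rewrite -lerN2; apply: (@continuous_ae_ge R n (fun y => - Q y)%R) => //.
    by move=> y; apply: (@continuousN _ _ _ Q y); exact: cQ.
  have := @ess_sup_ge _ _ R (lebesgue_rV R n) q.
  by apply: filterS => y; rewrite -/(exponent_sup q) q1E qE lee_fin lerN2.
have PQ x : (P x <= Q x)%R by rewrite -lee_fin -pE -qE.
have P0 x : (0 < P x)%R by rewrite (lt_le_trans _ (p0P x))// (lt_trans _ p01).
have Q0 x : (0 < Q x)%R by exact: lt_le_trans (PQ x).
have def x : (n%:R / P x - (1 + a - b) = n%:R / Q x)%R.
  have := hdefect x; rewrite pE qE !inver -/(P x) -/(Q x) !gt_eqF// => -[h].
  have -> : ((P x)^-1 = (Q x)^-1 + (n%:R^-1 + (a - b) / n%:R))%R by move: h; lra.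
  by field; rewrite !gt_eqF.
have al01 : (0 <= 1 + a - b <= 1)%R.
  apply/andP; split; last by move: hab; lra.
  have := def 0%R; have : (n%:R / Q 0 <= n%:R / P 0)%R.
    by rewrite ler_pM2l// lef_pV2 ?posrE.
  by lra.
have q10 : (0 < q1)%R by exact: lt_le_trans (Qq 0%R).
have ep0 : (0 < a + n%:R / q1)%R.
  move: ha; rewrite q1E inver gt_eqF// -EFinM -EFinN lte_fin; lra.
have [L H] := log_hoelder_admissible hn C0 LH LHoo (continuous_measurable_rV cP)
  (continuous_measurable_rV cQ) p01 p0P PQ Qq al01 def ep0 (lexx _).
have [K [K0 HK]] := weighted_modular_bound H.
exists K; split => // f sf cf.
rewrite -lee_pdivrMl//; apply: le_ereal_inf_tmp => _ [l [l0 hl] <-].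
rewrite lee_pdivrMl//; apply: ereal_inf_lbound; exists (K * l)%R => //=.
by split; [exact: mulr_gt0|exact: HK].
Qed.
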